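(* Let $\mathscr{A}$ be an abelian category, $\mathscr{X}$ a self-orthogonal additive subcategory of $\mathscr{A}$, and $M$ an object in $\mathscr{A}$ with $\mathcal{G}(\mathscr{X})\text{-}\dim M<\infty$. Then the following statements are equivalent for any $n\geq 0$. (1) $\mathcal{G}(\mathscr{X})\text{-}\dim M\leq n$. (2) There exists an exact sequence $0\to C_n\to X_{n-1}\to\cdots\to X_1\to X_0\to M\to 0$ in $\mathscr{A}$ with $C_n$ an object in $\mathcal{G}(\mathscr{X})$ and all $X_i$ objects in $\mathscr{X}$. (3) There exists an exact sequence $0\to X_n\to X_{n-1}\to\cdots\to X_1\to C_0\to M\to 0$ in $\mathscr{A}$ with $C_0$ an object in $\mathcal{G}(\mathscr{X})$ and all $X_i$ objects in $\mathscr{X}$. (4) For every integer $t$ with $0\leq t\leq n$, there exists an exact sequence $0\to X_n\to\cdots\to X_1\to X_0\to M\to 0$ in $\mathscr{A}$ such that $X_t$ is an object in $\mathcal{G}(\mathscr{X})$ and all $X_i$ with $i\neq t$ are objects in $\mathscr{X}$. (5) $\operatorname{Ext}_{\mathscr{A}}^{n+i}(M,X)=0$ for any object $X$ in $\mathscr{X}$ and any $i\geq 1$. (6) $\operatorname{Ext}_{\mathscr{A}}^{n+1}(M,Y)=0$ for any object $Y$ in $\mathscr{A}$ with $\mathscr{X}\text{-}\dim Y<\infty$. (7) $\operatorname{Ext}_{\mathscr{A}}^{n+i}(M,Y)=0$ for any object $Y$ in $\mathscr{A}$ with $\mathscr{X}\text{-}\dim Y<\infty$ and any $i\geq 1$.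
   Context: All subcategories are full, closed under isomorphisms, and additive, i.e. closed under finite direct sums (in particular containing the zero object). $\mathscr{X}$ is self-orthogonal if $\operatorname{Ext}_{\mathscr{A}}^i(X,X')=0$ for all objects $X,X'$ in $\mathscr{X}$ and all $i\geq 1$. For a subcategory $\mathscr{D}$, $\mathscr{D}\text{-}\dim M$ is the infimum of the integers $n\geq 0$ for which there exists an exact sequence $0\to D_n\to\cdots\to D_0\to M\to 0$ in $\mathscr{A}$ with all $D_i$ in $\mathscr{D}$ (infinity if none exists). $\mathcal{G}(\mathscr{X})$ is the subcategory of all objects $M$ for which there is an exact sequence $\cdots\to X_1\to X_0\to X^0\to X^1\to\cdots$ with all terms in $\mathscr{X}$, which remains exact after applying $\operatorname{Hom}_{\mathscr{A}}(X,-)$ and after applying $\operatorname{Hom}_{\mathscr{A}}(-,X)$ for every $X$ in $\mathscr{X}$, such that $M\cong\operatorname{Im}(X_0\to X^0)$. $\operatorname{Ext}_{\mathscr{A}}^i$ denotes (Yoneda) Ext in $\mathscr{A}$. *)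

(* Defs.v *)
From Stdlib Require Import Relation_Operators.
From mathcomp Require Import all_boot ssralg.
From mathcomp Require Import boolp.

Set Implicit Arguments.
Unset Strict Implicit.
Unset Printing Implicit Defensive.

Import GRing.Theory.
Local Open Scope ring_scope.

Reserved Notation "g \oc f" (at level 40, left associativity).

(* Hom sets are abelian groups; the eqType and choiceType layers contained in
   zmodType exist on every type by classical choice. *)
Record preadditive_category := Preadditive {
  ob :> Type;
  hom : ob -> ob -> zmodType;
  idm : forall A : ob, hom A A;
  compm : forall A B C : ob, hom B C -> hom A B -> hom A C;
  compmA : forall (A B C D : ob) (h : hom C D) (g : hom B C) (f : hom A B),
    compm h (compm g f) = compm (compm h g) f;
  comp1m : forall (A B : ob) (f : hom A B), compm (idm B) f = f;
  compm1 : forall (A B : ob) (f : hom A B), compm f (idm A) = f;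
  compmDl : forall (A B C : ob) (g h : hom B C) (f : hom A B),
    compm (g + h) f = compm g f + compm h f;
  compmDr : forall (A B C : ob) (g : hom B C) (f h : hom A B),
    compm g (f + h) = compm g f + compm g h
}.

Arguments idm {p} A.
Notation "g \oc f" := (compm g f).

Section Preadditive.
Variable A : preadditive_category.
Implicit Types B C D S Z : A.

Definition zero_object Z : Prop :=
  (forall B (f : hom B Z), f = 0) /\ (forall B (f : hom Z B), f = 0).

Definition is_iso B C (f : hom B C) : Prop :=
  exists g : hom C B, g \oc f = idm B /\ f \oc g = idm C.

Definition isomorphic B C : Prop := exists f : hom B C, is_iso f.

Definition biproduct B C S : Prop :=
  exists (i1 : hom B S) (i2 : hom C S) (p1 : hom S B) (p2 : hom S C),
    [/\ p1 \oc i1 = idm B, p2 \oc i2 = idm C,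
        p1 \oc i2 = 0, p2 \oc i1 = 0 & i1 \oc p1 + i2 \oc p2 = idm S].

Definition mono B C (f : hom B C) : Prop :=
  forall Z (u v : hom Z B), f \oc u = f \oc v -> u = v.

Definition epi B C (f : hom B C) : Prop :=
  forall Z (u v : hom C Z), u \oc f = v \oc f -> u = v.

Definition is_kernel B C D (f : hom C D) (k : hom B C) : Prop :=
  f \oc k = 0 /\
  forall Z (g : hom Z C), f \oc g = 0 -> exists! h : hom Z B, k \oc h = g.

Definition is_cokernel B C D (f : hom B C) (c : hom C D) : Prop :=
  c \oc f = 0 /\
  forall Z (g : hom C Z), g \oc f = 0 -> exists! h : hom D Z, h \oc c = g.

(* The image of f is the kernel of the cokernel of f. *)
Definition is_image I B C (f : hom B C) (m : hom I C) : Prop :=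
  exists (D : A) (c : hom C D), is_cokernel f c /\ is_kernel c m.

(* Im f = Ker g as subobjects of C. *)
Definition exact_at B C D (f : hom B C) (g : hom C D) : Prop :=
  exists (I : A) (m : hom I C), is_image f m /\ is_kernel g m.

End Preadditive.

Record abelian_category := Abelian {
  abelian_preadditive :> preadditive_category;
  has_zero : exists Z : abelian_preadditive, zero_object Z;
  has_biproducts : forall B C : abelian_preadditive, exists S, biproduct B C S;
  has_kernels : forall (B C : abelian_preadditive) (f : hom B C),
    exists (K : abelian_preadditive) (k : hom K B), is_kernel f k;
  has_cokernels : forall (B C : abelian_preadditive) (f : hom B C),
    exists (Q : abelian_preadditive) (c : hom C Q), is_cokernel f c;
  mono_is_kernel : forall (B C : abelian_preadditive) (f : hom B C), mono f ->
    exists (D : abelian_preadditive) (g : hom C D), is_kernel g f;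
  epi_is_cokernel : forall (B C : abelian_preadditive) (f : hom B C), epi f ->
    exists (D : abelian_preadditive) (g : hom D B), is_cokernel g f
}.

Section Abelian.
Variable A : abelian_category.
Implicit Types (M N B C D : A) (X : A -> Prop).

(* aug M D is the sequence M, D 0, D 1, ..., so that a family of morphisms
   d k : D k -> aug M D k is a diagram ... -> D 1 -> D 0 -> M. *)
Definition aug M (D : nat -> A) (k : nat) : A :=
  if k is j.+1 then D j else M.

Definition aug_map M (D D' : nat -> A) (f : forall k, hom (D k) (D' k))
    (k : nat) : hom (aug M D k) (aug M D' k) :=
  match k with 0 => idm M | j.+1 => f j end.

(* The sequence 0 -> N -> E n -> ... -> E 0 -> M -> 0 is exact.
   Here and below the terms of index greater than n play no role. *)
Definition exact_sequence n N M (E : nat -> A)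
    (d : forall k, hom (E k) (aug M E k)) (i : hom N (E n)) : Prop :=
  [/\ epi (d 0%N),
      forall k, (k < n)%N -> @exact_at A (E k.+1) (E k) _ (d k.+1) (d k),
      exact_at i (d n) & mono i].

(* n.+1-fold Yoneda extensions of M by N *)
Record extension n M N := Extension {
  ext_ob : nat -> A;
  ext_diff : forall k, hom (ext_ob k) (aug M ext_ob k);
  ext_inj : hom N (ext_ob n);
  ext_exact : exact_sequence ext_diff ext_inj
}.

Definition extension_morphism n M N (e e' : extension n M N) : Prop :=
  exists f : forall k, hom (ext_ob e k) (ext_ob e' k),
    (forall k, (k <= n)%N ->
       ext_diff e' k \oc f k = aug_map M f k \oc ext_diff e k)
    /\ f n \oc ext_inj e = ext_inj e'.

Definition Yoneda_equiv n M N : extension n M N -> extension n M N -> Prop :=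
  clos_refl_sym_trans _ (@extension_morphism n M N).

(* Ext^i(M, N) = 0. In positive degree, Ext^i(M, N) is the set of Yoneda classes
   of i-fold extensions; it contains the class of the trivial extension, which is
   its zero, so it vanishes iff there is no second class. *)
Definition Ext_eq0 (i : nat) M N : Prop :=
  match i with
  | 0 => forall f : hom M N, f = 0
  | n.+1 => forall e e' : extension n M N, Yoneda_equiv e e'
  end.

(* There is an exact sequence 0 -> D n -> ... -> D 0 -> M -> 0 with D k in P k. *)
Definition has_resolution (P : nat -> A -> Prop) n M : Prop :=
  exists (D : nat -> A) (d : forall k, hom (D k) (aug M D k)),
    [/\ epi (d 0%N),
        forall k, (k < n)%N -> @exact_at A (D k.+1) (D k) _ (d k.+1) (d k),
        mono (d n) & forall k, (k <= n)%N -> P k (D k)].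

(* The value None stands for infinity. *)
Definition dim X M : option nat :=
  if pselect (exists n, `[< has_resolution (fun=> X) n M >]) is left h
  then Some (ex_minn h) else None.

Definition dim_le X M n : bool := if dim X M is Some m then (m <= n)%N else false.

Definition dim_finite X M : Prop := dim X M <> None.

Definition additive_subcategory X : Prop :=
  [/\ forall B C, isomorphic B C -> X B -> X C,
      forall Z : A, zero_object Z -> X Z &
      forall B C S : A, X B -> X C -> biproduct B C S -> X S].

Definition self_orthogonal X : Prop :=
  forall B C, X B -> X C -> forall i, (0 < i)%N -> Ext_eq0 i B C.

Definition group_exact (U V W : zmodType) (F : U -> V) (G : V -> W) : Prop :=
  forall v : V, G v = 0 <-> exists u : U, F u = v.

(* B -> C -> D is exact, and stays so under Hom(T, -) and Hom(-, T), T in X. *)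
Definition X_exact_at X B C D (f : hom B C) (g : hom C D) : Prop :=
  exact_at f g /\
  forall T : A, X T ->
    group_exact (fun u : hom T B => f \oc u) (fun u : hom T C => g \oc u) /\
    group_exact (fun u : hom D T => u \oc g) (fun u : hom C T => u \oc f).

(* L and R are the left and right halves of
   ... -> L 1 -> L 0 -> R 0 -> R 1 -> ..., and dL 0 : L 0 -> R 0. *)
Definition Gorenstein X M : Prop :=
  exists (L R : nat -> A) (dL : forall k, hom (L k) (aug (R 0%N) L k))
         (dR : forall k, hom (R k) (R k.+1)),
    [/\ forall k, X (L k) /\ X (R k),
        forall k, @X_exact_at X (L k.+1) (L k) _ (dL k.+1) (dL k),
        @X_exact_at X (L 0%N) (R 0%N) _ (dL 0%N) (dR 0%N),
        forall k, X_exact_at X (dR k) (dR k.+1) &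
        exists (I : A) (m : hom I (R 0%N)),
          @is_image A I (L 0%N) (R 0%N) (dL 0%N) m /\ isomorphic M I].

End Abelian.

(* Main.v *)
(* Classes in Ext^n(M, N) are represented by cocycles g : P_n -> N on resolutions
   P of M by arbitrary objects, a class being zero when g becomes a coboundary on some
   resolution refining P. After refinement every resolution behaves as if it were
   projective (maps lift, and lifts are unique up to homotopy), so mapping cones give
   the long exact sequences although the category need not have enough projectives;
   vanishing of all classes is equivalent to vanishing of Yoneda Ext.
   Write G for the Gorenstein objects. An object of G has an X-cover with kernel in G
   and an X-envelope with cokernel in G, and G is closed under extensions; pullbacks
   along covers and pushouts along envelopes then move the G-term of a resolution to
   any place, and dimension shifting bounds Ext. Conversely, if M has finite
   G-dimension and Ext^(n+1)(M, -) kills the objects of finite X-dimension, then for an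
   n-th syzygy K of M relative to X the sequence 0 -> Y -> C -> K -> 0 with C in G
   and Y of finite X-dimension splits; hence K is orthogonal to X, and descending
   induction on the G-dimension, where only summands with complement in X occur, puts
   K in G. *)
Require Import Defs.
From mathcomp Require Import all_boot ssralg boolp.

Set Implicit Arguments.
Unset Strict Implicit.
Unset Printing Implicit Defensive.

Import GRing.Theory.

(** * Abelian categories *)

(** Condition (6) sees a single degree, yet it must force orthogonality to [X] in all degrees. This
    is why its coefficients run over all objects of finite X-dimension: the kernel [Y] of an
    approximation [C -> K] is such an object, in general outside [X], and once the approximation
    splits, [K] inherits from [C] the vanishing in every degree. Being a retract of [C] does not by
    itself put [K] in G, since [Y] need not be Gorenstein; a complement in [X] is Gorenstein, so
    that the syzygies and cosyzygies of the summand become extensions of objects of G. Membership in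
    G asks for an infinite complex; closure properties are therefore reduced to one step in each
    direction by a coinduction principle. Nullity of a class is a mere existence statement, so
    neither the Ext groups nor the Baer sum is ever formed. *)

Section AbelianBasics.
Local Open Scope ring_scope.
Variable A : abelian_category.
Implicit Types B C D K L M N P Q T U V W Z : A.

Lemma compm0 B C D (g : hom C D) : g \oc (0 : hom B C) = 0.
Proof. by apply: (addrI (g \oc 0)); rewrite -compmDr !addr0. Qed.

Lemma comp0m B C D (f : hom B C) : (0 : hom C D) \oc f = 0.
Proof. by apply: (addrI (0 \oc f)); rewrite -compmDl !addr0. Qed.

Lemma compmNr B C D (g : hom C D) (f : hom B C) : g \oc (- f) = - (g \oc f).
Proof. by apply: (addrI (g \oc f)); rewrite -compmDr !subrr compm0. Qed.

Lemma compmNl B C D (g : hom C D) (f : hom B C) : (- g) \oc f = - (g \oc f).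
Proof. by apply: (addrI (g \oc f)); rewrite -compmDl !subrr comp0m. Qed.

Lemma compmBr B C D (g : hom C D) (f h : hom B C) :
  g \oc (f - h) = g \oc f - g \oc h.
Proof. by rewrite compmDr compmNr. Qed.

Lemma compmBl B C D (g h : hom C D) (f : hom B C) :
  (g - h) \oc f = g \oc f - h \oc f.
Proof. by rewrite compmDl compmNl. Qed.

Lemma congl B C D E (g : hom C D) (f : hom B C) (h : hom B D) (z : hom E B) :
  g \oc f = h -> g \oc (f \oc z) = h \oc z.
Proof. by move<-; rewrite compmA. Qed.

Lemma monoP B C (f : hom B C) :
  mono f <-> forall Z (u : hom Z B), f \oc u = 0 -> u = 0.
Proof.
split=> [fm Z u fu|f0 Z u v fuv]; first by apply: fm; rewrite compm0.
by apply: subr0_eq; apply: f0; rewrite compmBr fuv subrr.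
Qed.

Lemma epiP B C (f : hom B C) :
  epi f <-> forall Z (u : hom C Z), u \oc f = 0 -> u = 0.
Proof.
split=> [fe Z u fu|f0 Z u v fuv]; first by apply: fe; rewrite comp0m.
by apply: subr0_eq; apply: f0; rewrite compmBl fuv subrr.
Qed.

Lemma epi0 B C (f : hom B C) Z (u : hom C Z) : epi f -> u \oc f = 0 -> u = 0.
Proof. by move=> fe; apply: (proj1 (epiP f) fe). Qed.

Lemma mono0 B C (f : hom B C) Z (u : hom Z B) : mono f -> f \oc u = 0 -> u = 0.
Proof. by move=> fm; apply: (proj1 (monoP f) fm). Qed.

Lemma kernel_mono B C D (f : hom C D) (k : hom B C) : is_kernel f k -> mono k.
Proof.
case=> fk kP Z u v kuv; have [|h [_ hU]] := kP _ (k \oc u).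
  by rewrite compmA fk comp0m.
by rewrite -(hU u)// -(hU v).
Qed.

Lemma cokernel_epi B C D (f : hom B C) (c : hom C D) : is_cokernel f c -> epi c.
Proof.
case=> cf cP Z u v cuv; have [|h [_ hU]] := cP _ (u \oc c).
  by rewrite -compmA cf compm0.
by rewrite -(hU u)// -(hU v).
Qed.

Lemma kernel_lift B C D (f : hom C D) (k : hom B C) Z (g : hom Z C) :
  is_kernel f k -> f \oc g = 0 -> exists h : hom Z B, k \oc h = g.
Proof. by case=> _ kP /kP [h [hE _]]; exists h. Qed.

Lemma cokernel_desc B C D (f : hom B C) (c : hom C D) Z (g : hom C Z) :
  is_cokernel f c -> g \oc f = 0 -> exists h : hom D Z, h \oc c = g.
Proof. by case=> _ cP /cP [h [hE _]]; exists h. Qed.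

Lemma is_kernelP B C D (f : hom C D) (k : hom B C) :
  is_kernel f k <-> [/\ f \oc k = 0, mono k &
    forall Z (g : hom Z C), f \oc g = 0 -> exists h : hom Z B, k \oc h = g].
Proof.
split=> [kk|[fk km kl]].
  by split; [case: kk|apply: kernel_mono kk|move=> Z g; apply: kernel_lift].
split=> // Z g /kl [h hE]; exists h; split=> // h' h'E.
by apply: km; rewrite hE.
Qed.

Lemma is_cokernelP B C D (f : hom B C) (c : hom C D) :
  is_cokernel f c <-> [/\ c \oc f = 0, epi c &
    forall Z (g : hom C Z), g \oc f = 0 -> exists h : hom D Z, h \oc c = g].
Proof.
split=> [kk|[fk km kl]].
  by split; [case: kk|apply: cokernel_epi kk|move=> Z g; apply: cokernel_desc].
split=> // Z g /kl [h hE]; exists h; split=> // h' h'E.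
by apply: km; rewrite hE.
Qed.

Lemma mono_kernel_cokernel B C D (m : hom B C) (c : hom C D) :
  mono m -> is_cokernel m c -> is_kernel c m.
Proof.
move=> mm mc; have [E [g /is_kernelP[gm _ gl]]] := mono_is_kernel mm.
apply/is_kernelP; split=> // [|Z z cz]; first by case: mc.
have [h hE] := cokernel_desc mc gm.
by apply: gl; rewrite -hE -compmA cz compm0.
Qed.

Lemma epi_cokernel_kernel B C D (k : hom B C) (e : hom C D) :
  epi e -> is_kernel e k -> is_cokernel k e.
Proof.
move=> ee ek; have [E [g /is_cokernelP[gm _ gl]]] := epi_is_cokernel ee.
apply/is_cokernelP; split=> // [|Z z cz]; first by case: ek.
have [h hE] := kernel_lift ek gm.
by apply: gl; rewrite -hE compmA cz comp0m.
Qed.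

(** Epi part: if [u \oc e = 0], then [e] lands in the kernel [k] of [u]. The mono [m \oc k] is the
    kernel of some [h], and [h] kills [f], hence factors through the cokernel [c] and kills [m] as
    well. So [m] factors through [m \oc k], which makes [k] a split epi and [u] zero. *)
Lemma is_image_factor I B C (f : hom B C) (m : hom I C) :
  is_image f m -> mono m /\ exists e : hom B I, epi e /\ m \oc e = f.
Proof.
case=> [D [c [fc cm]]]; have mm := kernel_mono cm; split=> //.
have [e eE] : exists e : hom B I, m \oc e = f.
  by apply: kernel_lift cm _; case: fc.
exists e; split=> //; apply/epiP => Z u ue.
have [I' [k uk]] := has_kernels u.
have [e' e'E] := kernel_lift uk ue.
have mkm : mono (m \oc k).
  move=> T a b; rewrite -!compmA => /mm; exact: (kernel_mono uk).
have [E [h hk]] := mono_is_kernel mkm.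
have hf : h \oc f = 0.
  by rewrite -eE -e'E !compmA -(compmA h); case: hk => -> _; rewrite comp0m.
have [h' h'E] := cokernel_desc fc hf.
have hm : h \oc m = 0 by rewrite -h'E -compmA; case: cm => -> _; rewrite compm0.
have [w wE] := kernel_lift hk hm.
have kw : k \oc w = idm I by apply: mm; rewrite compmA wE compm1.
by rewrite -(compm1 u) -kw compmA; case: uk => -> _; rewrite comp0m.
Qed.

Lemma image_exists B C (f : hom B C) : exists I (m : hom I C), is_image f m.
Proof.
have [D [c fc]] := has_cokernels f; have [I [m cm]] := has_kernels c.
by exists I, m, D, c.
Qed.

Record biprod B C := Biprod {
  biprod_ob : A;
  in1 : hom B biprod_ob; in2 : hom C biprod_ob;
  pr1 : hom biprod_ob B; pr2 : hom biprod_ob C;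
  pr1in1 : pr1 \oc in1 = idm B; pr2in2 : pr2 \oc in2 = idm C;
  pr1in2 : pr1 \oc in2 = 0; pr2in1 : pr2 \oc in1 = 0;
  in_pr : in1 \oc pr1 + in2 \oc pr2 = idm biprod_ob }.

Lemma biprod_exists B C : exists _ : biprod B C, True.
Proof.
have [S [inj1 [inj2 [prj1 [prj2 [e1 e2 e3 e4 e5]]]]]] := has_biproducts B C.
by exists (@Biprod B C S inj1 inj2 prj1 prj2 e1 e2 e3 e4 e5).
Qed.

Definition bp_data B C : biprod B C := sval (cid (biprod_exists B C)).
Definition bp B C : A := biprod_ob (bp_data B C).
Definition inj1 B C : hom B (bp B C) := in1 (bp_data B C).
Definition inj2 B C : hom C (bp B C) := in2 (bp_data B C).
Definition prj1 B C : hom (bp B C) B := pr1 (bp_data B C).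
Definition prj2 B C : hom (bp B C) C := pr2 (bp_data B C).
Arguments inj1 {B C}. Arguments inj2 {B C}. Arguments prj1 {B C}. Arguments prj2 {B C}.
Definition pair B C Z (b : hom Z B) (c : hom Z C) : hom Z (bp B C) :=
  inj1 \oc b + inj2 \oc c.

Lemma prj1_inj1 B C : prj1 \oc @inj1 B C = idm B.
Proof. exact: (pr1in1 (bp_data B C)). Qed.
Lemma prj2_inj2 B C : prj2 \oc @inj2 B C = idm C.
Proof. exact: (pr2in2 (bp_data B C)). Qed.
Lemma prj1_inj2 B C : prj1 \oc @inj2 B C = 0.
Proof. exact: (pr1in2 (bp_data B C)). Qed.
Lemma prj2_inj1 B C : prj2 \oc @inj1 B C = 0.
Proof. exact: (pr2in1 (bp_data B C)). Qed.

Lemma prj1_pair B C Z (b : hom Z B) (c : hom Z C) : prj1 \oc pair b c = b.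
Proof. by rewrite compmDr !compmA prj1_inj1 prj1_inj2 comp1m comp0m addr0. Qed.

Lemma prj2_pair B C Z (b : hom Z B) (c : hom Z C) : prj2 \oc pair b c = c.
Proof. by rewrite compmDr !compmA prj2_inj1 prj2_inj2 comp1m comp0m add0r. Qed.

Lemma pair_eta B C Z (u : hom Z (bp B C)) : pair (prj1 \oc u) (prj2 \oc u) = u.
Proof. by rewrite /pair !compmA -compmDl (in_pr (bp_data B C)) comp1m. Qed.

Lemma pair_comp B C Z Y (b : hom Z B) (c : hom Z C) (z : hom Y Z) :
  pair b c \oc z = pair (b \oc z) (c \oc z).
Proof. by rewrite /pair compmDl -!compmA. Qed.

Lemma pair_ext B C Z (u v : hom Z (bp B C)) :
  prj1 \oc u = prj1 \oc v -> prj2 \oc u = prj2 \oc v -> u = v.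
Proof. by move=> e1 e2; rewrite -(pair_eta u) -(pair_eta v) e1 e2. Qed.

Lemma bp_biproduct B C : biproduct B C (bp B C).
Proof.
exists inj1, inj2, prj1, prj2; split;
  [exact: prj1_inj1|exact: prj2_inj2|exact: prj1_inj2|exact: prj2_inj1|].
exact: (in_pr (bp_data B C)).
Qed.

Lemma pullback_exists B C D (f : hom B D) (g : hom C D) :
  exists P (a : hom P B) (b : hom P C), [/\ f \oc a = g \oc b,
    forall Z (u v : hom Z P), a \oc u = a \oc v -> b \oc u = b \oc v -> u = v &
    forall Z (u : hom Z B) (v : hom Z C), f \oc u = g \oc v ->
      exists w : hom Z P, a \oc w = u /\ b \oc w = v].
Proof.
have [P [k kk]] := has_kernels (f \oc prj1 - g \oc prj2).
exists P, (prj1 \oc k), (prj2 \oc k); split.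
- by apply: subr0_eq; rewrite !compmA -compmBl; case: kk.
- move=> Z u v; rewrite -!compmA => e1 e2.
  by apply: (kernel_mono kk); apply: pair_ext.
- move=> Z u v e; have [|w wE] := @kernel_lift _ _ _ _ _ _ (pair u v) kk.
    by rewrite compmBl -!compmA prj1_pair prj2_pair e subrr.
  by exists w; rewrite -!compmA wE prj1_pair prj2_pair.
Qed.

(** The difference map [dl] is epi, hence the cokernel of its kernel, and that kernel factors
    through [P]. So a map [w] with [w \oc b = 0] induces [v] on [D] with [v \oc f = 0]; thus [v],
    and then [w], is zero. *)
Lemma epi_pullback B C D P (f : hom B D) (g : hom C D) (a : hom P B) (b : hom P C) :
  f \oc a = g \oc b ->
  (forall Z (u : hom Z B) (v : hom Z C), f \oc u = g \oc v ->
      exists w : hom Z P, a \oc w = u /\ b \oc w = v) ->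
  epi f -> epi b.
Proof.
move=> fagb Pl fe; apply/epiP => Z w wb.
set dl := f \oc prj1 - g \oc prj2.
have dle : epi dl.
  apply/epiP => Y u udl; apply: (epi0 fe).
  have := congr1 (fun x => x \oc inj1) udl.
  by rewrite /dl compmBr compmBl -!compmA prj1_inj1 prj2_inj1 !compm0 subr0 compm1
    comp0m.
have [K [k kk]] := has_kernels dl.
have kc := epi_cokernel_kernel dle kk.
have wk : (w \oc prj2) \oc k = 0.
  have [|z [_ z2]] := Pl _ (prj1 \oc k) (prj2 \oc k).
    by apply: subr0_eq; rewrite !compmA -compmBl; case: kk.
  by rewrite -compmA -z2 compmA wb comp0m.
have [v vE] := cokernel_desc kc wk.
have v0 : v = 0.
  apply: (epi0 fe).
  have := congr1 (fun x => x \oc inj1) vE.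
  by rewrite /dl compmBr compmBl -!compmA prj1_inj1 prj2_inj1 !compm0 subr0 compm1.
have := congr1 (fun x => x \oc inj2) vE.
by rewrite v0 comp0m comp0m -compmA prj2_inj2 compm1.
Qed.

Lemma epi_local B C (f : hom B C) T (z : hom T C) : epi f ->
  exists T' (t : hom T' T) (y : hom T' B), epi t /\ f \oc y = z \oc t.
Proof.
move=> fe; have [P [a [b [e _ l]]]] := pullback_exists f z.
by exists P, b, a; split=> //; apply: epi_pullback e l fe.
Qed.

Lemma epi_comp B C D (g : hom C D) (f : hom B C) : epi g -> epi f -> epi (g \oc f).
Proof. by move=> ge fe Z u v; rewrite !compmA => /fe /ge. Qed.

Lemma mono_comp B C D (g : hom C D) (f : hom B C) : mono g -> mono f -> mono (g \oc f).
Proof. by move=> ge fe Z u v; rewrite -!compmA => /ge /fe. Qed.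

Lemma epi_of_comp B C D (g : hom C D) (f : hom B C) : epi (g \oc f) -> epi g.
Proof. by move=> ge Z u v e; apply: ge; rewrite !compmA e. Qed.

Lemma mono_of_comp B C D (g : hom C D) (f : hom B C) : mono (g \oc f) -> mono f.
Proof. by move=> ge Z u v e; apply: ge; rewrite -!compmA e. Qed.

Lemma epi_id B : epi (idm B).
Proof. by move=> Z u v; rewrite !compm1. Qed.

Lemma mono_id B : mono (idm B).
Proof. by move=> Z u v; rewrite !comp1m. Qed.

Lemma local_epi B C (f : hom B C) :
  (forall T (z : hom T C), exists T' (t : hom T' T) (y : hom T' B),
     epi t /\ f \oc y = z \oc t) -> epi f.
Proof.
move=> /(_ _ (idm C)) [T' [t [y [te]]]]; rewrite comp1m => e.
by apply: (@epi_of_comp _ _ _ f y); rewrite e.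
Qed.

(* Exactness by lifting along epimorphic refinements of generalized elements. *)
Definition exact_el B C D (f : hom B C) (g : hom C D) : Prop :=
  g \oc f = 0 /\ forall T (z : hom T C), g \oc z = 0 ->
    exists T' (t : hom T' T) (y : hom T' B), epi t /\ f \oc y = z \oc t.

Lemma exact_atP B C D (f : hom B C) (g : hom C D) :
  exact_at f g <-> exact_el f g.
Proof.
split=> [[I [m [fm gm]]]|[gf fl]].
  have [mm [e [ee eE]]] := is_image_factor fm; split.
    by rewrite -eE compmA; case: gm => -> _; rewrite comp0m.
  move=> T z gz; have [z' z'E] := kernel_lift gm gz.
  have [T' [t [y [te yE]]]] := epi_local z' ee.
  by exists T', t, y; split=> //; rewrite -eE -compmA yE compmA z'E.
have [I [m fm]] := image_exists f; exists I, m; split=> //.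
have [mm [e [ee eE]]] := is_image_factor fm.
apply/is_kernelP; split=> //.
  by apply: ee; rewrite -compmA eE gf comp0m.
move=> Z z gz; case: fm => D' [c [fc cm]]; apply: kernel_lift cm _.
have [T' [t [y [te yE]]]] := fl _ _ gz.
apply: (epi0 te); rewrite -compmA -yE compmA.
by case: fc => -> _; rewrite comp0m.
Qed.

Lemma exact_mono0 Z B C (f : hom B C) : mono f -> exact_el (0 : hom Z B) f.
Proof.
move=> fm; split; first exact: compm0.
move=> T z /(mono0 fm) ->; exists T, (idm T), 0.
by split; [exact: epi_id|rewrite compm0 comp0m].
Qed.

Lemma exact_kernel B C D (f : hom B C) (g : hom C D) :
  exact_el f g -> mono f -> is_kernel g f.
Proof.
move=> [gf fl] fm; apply/is_kernelP; split=> // Z z gz.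
have [D' [c fc]] := has_cokernels f.
apply: kernel_lift (mono_kernel_cokernel fm fc) _.
have [T' [t [y [te yE]]]] := fl _ _ gz.
apply: (epi0 te); rewrite -compmA -yE compmA.
by case: fc => -> _; rewrite comp0m.
Qed.

Lemma kernel_exact B C D E (k : hom B C) (g : hom C D) (e : hom E B) :
  is_kernel g k -> epi e -> exact_el (k \oc e) g.
Proof.
move=> gk ee; split; first by rewrite compmA; case: gk => -> _; rewrite comp0m.
move=> T z /(kernel_lift gk) [z' z'E].
have [T' [t [y [te yE]]]] := epi_local z' ee.
by exists T', t, y; split=> //; rewrite -compmA yE compmA z'E.
Qed.

Lemma exact_monol B C D D' (f : hom B C) (g : hom C D) (m : hom D D') :
  mono m -> exact_el f g <-> exact_el f (m \oc g).
Proof.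
move=> mm; split=> -[gf fl]; split.
- by rewrite -compmA gf compm0.
- by move=> T z; rewrite -compmA => /(mono0 mm); apply: fl.
- by apply: (mono0 mm); rewrite compmA.
- by move=> T z gz; apply: fl; rewrite -compmA gz compm0.
Qed.

Definition ses B C D (f : hom B C) (g : hom C D) := is_kernel g f /\ epi g.

Lemma ses_mono B C D (f : hom B C) (g : hom C D) : ses f g -> mono f.
Proof. by case=> /kernel_mono. Qed.

Lemma ses_epi B C D (f : hom B C) (g : hom C D) : ses f g -> epi g.
Proof. by case. Qed.

Lemma ses0 B C D (f : hom B C) (g : hom C D) : ses f g -> g \oc f = 0.
Proof. by case=> [[]]. Qed.

Lemma ses_coker B C D (f : hom B C) (g : hom C D) : ses f g -> is_cokernel f g.
Proof. by case=> k e; apply: epi_cokernel_kernel. Qed.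

Lemma ses_exact B C D (f : hom B C) (g : hom C D) : ses f g -> exact_el f g.
Proof. by case=> k _; rewrite -(compm1 f); apply: kernel_exact => //;
  apply: epi_id. Qed.

Lemma ses_lift B C D (f : hom B C) (g : hom C D) Z (z : hom Z C) :
  ses f g -> g \oc z = 0 -> exists h, f \oc h = z.
Proof. by case=> k _; apply: kernel_lift. Qed.

Lemma ses_desc B C D (f : hom B C) (g : hom C D) Z (z : hom C Z) :
  ses f g -> z \oc f = 0 -> exists h, h \oc g = z.
Proof. by move/ses_coker => c; apply: cokernel_desc. Qed.

Lemma coker_ses B C D (f : hom B C) (g : hom C D) : mono f -> is_cokernel f g -> ses f
  g.
Proof. by move=> m c; split; [apply: mono_kernel_cokernel|apply: cokernel_epi c]. Qed.

Lemma sesP B C D (f : hom B C) (g : hom C D) :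
  mono f -> epi g -> exact_el f g -> ses f g.
Proof. by move=> m e x; split=> //; apply: exact_kernel. Qed.

End AbelianBasics.

Arguments inj1 {A B C}. Arguments inj2 {A B C}. Arguments prj1 {A B C}. Arguments prj2
  {A B C}.

(** * Resolutions and homotopies *)

Section Resolutions.
Local Open Scope ring_scope.
Variable A : abelian_category.
Implicit Types B C D K L M N P Q T U V W Z : A.

Lemma exact_elN B C D (f : hom B C) (g : hom C D) :
  exact_el f g -> exact_el (- f) (- g).
Proof.
move=> [gf fl]; split; first by rewrite compmNl compmNr opprK.
move=> T z; rewrite compmNl => e.
have [|T' [t [y [te yE]]]] := fl _ z; first by rewrite -(opprK (_ \oc _)) e oppr0.
by exists T', t, (- y); split=> //; rewrite compmNl compmNr opprK.
Qed.

(** The triangular matrix with rows [(b, h)] and [(0, c)]: the shape of the differential of a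
    mapping cone, signs being put into [b] or [c]. *)
Definition twist B B' C C' (b : hom B B') (h : hom C B') (c : hom C C') :
  hom (bp B C) (bp B' C') :=
  pair (b \oc prj1 + h \oc prj2) (c \oc prj2).

Lemma twist_pair B B' C C' (b : hom B B') (h : hom C B') (c : hom C C') Z
    (x : hom Z B) (y : hom Z C) :
  twist b h c \oc pair x y = pair (b \oc x + h \oc y) (c \oc y).
Proof. by rewrite pair_comp compmDl -!compmA prj1_pair prj2_pair. Qed.

Lemma twist_elem B B' C C' (b : hom B B') (h : hom C B') (c : hom C C') Z
    (z : hom Z (bp B C)) :
  twist b h c \oc z = pair (b \oc (prj1 \oc z) + h \oc (prj2 \oc z)) (c \oc (prj2 \oc
    z)).
Proof. by rewrite -{1}(pair_eta z) twist_pair. Qed.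

(* Exactness of a mapping cone in one degree; the outgoing map [e] may be a
   truncation of the cone differential. *)
Lemma exact_twist B2 B1 B0 C2 C1 C0 E (b2 : hom B2 B1) (b1 : hom B1 B0)
    (h2 : hom C2 B1) (h1 : hom C1 B0) (c2 : hom C2 C1) (c1 : hom C1 C0)
    (e : hom (bp B1 C1) E) :
  exact_el b2 b1 -> exact_el c2 c1 -> b1 \oc h2 + h1 \oc c2 = 0 ->
  e \oc twist b2 h2 c2 = 0 ->
  (forall Z (x : hom Z B1) (y : hom Z C1), e \oc pair x y = 0 ->
     c1 \oc y = 0 /\ b1 \oc x + h1 \oc y = 0) ->
  exact_el (twist b2 h2 c2) e.
Proof.
move=> [_ bl] [_ cl] bh et eP; split=> // T z ez.
have [cz bz] := eP _ (prj1 \oc z) (prj2 \oc z) (etrans (congr1 _ (pair_eta z)) ez).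
have [T1 [t1 [y [t1e yE]]]] := cl _ _ cz.
have [|T2 [t2 [x [t2e xE]]]] := bl _ ((prj1 \oc z) \oc t1 - h2 \oc y).
  have bh' : b1 \oc h2 = - (h1 \oc c2) by apply/eqP; rewrite -addr_eq0 bh.
  rewrite compmBr (congl _ bh') compmNl opprK -!compmA.
  have := congr1 (fun u => u \oc t1) bz; rewrite compmDl comp0m -!compmA => <-.
  by rewrite yE -!compmA; congr (_ + _).
exists T2, (t1 \oc t2), (pair x (y \oc t2)); split; first exact: epi_comp.
rewrite twist_pair xE compmBl -(compmA h2) addrNK.
apply: pair_ext; rewrite ?prj1_pair ?prj2_pair -?compmA//.
by rewrite compmA yE -!compmA.
Qed.

(** The terms are arbitrary objects; lifting properties come from passing to another resolution. The
    sequence is infinite, so cones of resolutions need no separate treatment at a far end. *)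
Record ires M := IRes {
  rob :> nat -> A;
  rd : forall k, hom (rob k) (aug M rob k);
  rd_epi : epi (rd 0%N);
  rd_exact : forall k, @exact_el A (rob k.+1) (rob k) _ (rd k.+1) (rd k) }.

Lemma rd_rd M (p : ires M) k : (rd p k : hom (p k) _) \oc (rd p k.+1 : hom (p k.+1) (p
  k)) = 0.
Proof. by case: (rd_exact p k). Qed.

Definition augm M M' (u : hom M M') (D D' : nat -> A)
    (f : forall k, hom (D k) (D' k)) k : hom (aug M D k) (aug M' D' k) :=
  match k with 0 => u | j.+1 => f j end.

Definition chain_map M M' (u : hom M M') (p : ires M) (q : ires M')
    (f : forall k, hom (p k) (q k)) : Prop :=
  forall k, rd q k \oc f k = augm u f k \oc rd p k.

Lemma chain_comp M M' M'' (u : hom M M') (v : hom M' M'') (p : ires M) (q : ires M')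
    (r : ires M'') f g : @chain_map _ _ u p q f -> @chain_map _ _ v q r g ->
  @chain_map _ _ (v \oc u) p r (fun k => g k \oc f k).
Proof.
move=> fc gc k; rewrite compmA gc -compmA fc compmA.
by case: k.
Qed.

Lemma chain_id M (p : ires M) : @chain_map _ _ (idm M) p p (fun k => idm _).
Proof. by move=> k; rewrite compm1; case: k => [|k]; rewrite comp1m. Qed.

Lemma chain_sub M M' (u v : hom M M') (p : ires M) (q : ires M') f g :
  @chain_map _ _ u p q f -> @chain_map _ _ v p q g ->
  @chain_map _ _ (u - v) p q (fun k => f k - g k).
Proof. by move=> fc gc [|k]; rewrite compmBr fc gc -compmBl. Qed.

(* A homotopy is a family [h k : p k -> r k.+1]; its component in degree -1 is 0. *)
Definition hprev M (p q : nat -> A) (h : forall k, hom (p k) (q k.+1)) k :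
    hom (aug M p k) (q k) :=
  match k with 0 => 0 | j.+1 => h j end.

Section NullHomotopy.
Variables (M M' : A) (p : ires M) (r : ires M') (f : forall k, hom (p k) (r k)).
Hypothesis fc : @chain_map _ _ 0 p r f.
Variables (P : A) (a : hom P (r 1%N)) (b : hom P (p 0%N)).
Hypothesis ab : rd r 1 \oc a = f 0%N \oc b.
Hypothesis ab_inj : forall Z (u v : hom Z P),
  a \oc u = a \oc v -> b \oc u = b \oc v -> u = v.
Hypothesis ab_lift : forall Z (u : hom Z (r 1%N)) (v : hom Z (p 0%N)),
  rd r 1 \oc u = f 0%N \oc v -> exists w : hom Z P, a \oc w = u /\ b \oc w = v.

(** The cocone of [f], with terms [r k.+1 + p k], cut off in degree 0 at the kernel [P] of the map
    to [r 0], that is, at the pullback of [rd r 1] and [f 0]. *)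
Let S k : A := match k with 0 => P | j.+1 => bp (r j.+2) (p j.+1) end.

Let D k : hom (bp (r k.+2) (p k.+1)) (bp (r k.+1) (p k)) :=
  twist (- rd r k.+2 : hom (r k.+2) (r k.+1)) (f k.+1 : hom (p k.+1) (r k.+1))
    (rd p k.+1 : hom (p k.+1) (p k)).

Let fc' k : rd r k.+1 \oc f k.+1 = f k \oc rd p k.+1.
Proof. exact: fc. Qed.

Let cocone_d1 : exists w : hom (bp (r 2%N) (p 1%N)) P, pair a b \oc w = D 0.
Proof.
have [|w [w1 w2]] := @ab_lift _ (prj1 \oc D 0) (prj2 \oc D 0).
  rewrite /D /twist prj1_pair prj2_pair compmDr !compmA compmNr (rd_rd r 1).
  by rewrite oppr0 comp0m add0r fc'.
by exists w; rewrite pair_comp w1 w2 pair_eta.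
Qed.

Let DD k : D k \oc D k.+1 = 0.
Proof.
rewrite /D; set x := twist (_ : hom (r k.+3) _) _ _.
rewrite twist_elem /x prj1_pair prj2_pair compmDr !compmA.
rewrite compmNl compmNr opprK (rd_rd r k.+2) !comp0m add0r compmNl.
rewrite fc' !compmNl addNr (rd_rd p k.+1) comp0m.
by rewrite /pair !compm0 addr0.
Qed.

(** On the cocone the projection to [p] is the refinement and the projection to [r] is the homotopy;
    the homotopy equation is the first row of the differential. *)
Lemma nullhomotopy_pullback : exists (p' : ires M) (s : forall k, hom (p' k) (p k)),
  @chain_map _ _ (idm M) p' p s /\
  exists h : forall k, hom (p' k) (r k.+1), forall k,
    f k \oc s k = (rd r k.+1 : hom (r k.+1) (r k)) \oc h k + hprev M h k \oc rd p' k.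
Proof.
have [w wE] := cocone_d1.
have wab : a \oc w = prj1 \oc D 0 /\ b \oc w = prj2 \oc D 0.
  by rewrite -wE !compmA prj1_pair prj2_pair.
pose d k : hom (S k) (aug M S k) :=
  match k return hom (S k) (aug M S k) with
  | 0 => rd p 0 \oc b | 1 => w | j.+2 => D j.+1 end.
have abm : mono (pair a b).
  move=> Z u v; rewrite !pair_comp => e; apply: ab_inj.
    by have := congr1 (fun z => prj1 \oc z) e; rewrite !prj1_pair.
  by have := congr1 (fun z => prj2 \oc z) e; rewrite !prj2_pair.
(* Since [f] lies over 0, [f 0] lands in the kernel of [rd r 0], which [rd r 1] covers. *)
have be : epi b.
  apply: local_epi => T z.
  have [|T' [t [y [te yE]]]] := (rd_exact r 0).2 _ (f 0%N \oc z).
    by rewrite compmA fc /= !comp0m.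
  have [|y' [_ y'E]] := @ab_lift _ y (z \oc t); first by rewrite yE compmA.
  by exists T', t, y'.
have Dex k : exact_el (D k.+1) (D k).
  apply: (exact_twist (h1 := f k.+1) (exact_elN (rd_exact r k.+2)) (rd_exact p k.+1) _
    (DD k)).
    by rewrite compmNl fc' addNr.
  move=> Z x y; rewrite /D twist_pair => e; split.
    by have := congr1 (fun z => prj2 \oc z) e; rewrite prj2_pair compm0.
  by have := congr1 (fun z => prj1 \oc z) e; rewrite prj1_pair compm0.
have de : epi (d 0%N) by apply: epi_comp => //; apply: rd_epi.
have dx k : @exact_el A (S k.+1) (S k) _ (d k.+1) (d k).
  case: k => [|[|k]] /=; last exact: Dex; last first.
    by apply/(exact_monol _ _ abm); rewrite wE; apply: Dex.
  have [wa wb] := wab; split.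
    by rewrite -compmA wb /D /twist prj2_pair !compmA (rd_rd p 0) comp0m.
  move=> T z; rewrite -compmA => e.
  have [T1 [t1 [y [t1e yE]]]] := (rd_exact p 0).2 _ _ e.
  have [|T2 [t2 [x [t2e xE]]]] := (rd_exact r 1).2 _ (f 1%N \oc y - (a \oc z) \oc t1).
    rewrite compmBr !compmA fc' ab -[X in X - _]compmA yE !compmA.
    exact: subrr.
  exists T2, (t1 \oc t2), (pair x (y \oc t2)); split; first exact: epi_comp.
  apply: abm; rewrite compmA wE /D twist_pair compmNl xE compmBl opprB -!compmA addrNK.
  by rewrite pair_comp (compmA _ y) yE -!compmA.
pose s k : hom (S k) (p k) := match k with 0 => b | j.+1 => prj2 end.
pose h k : hom (S k) (r k.+1) := match k with 0 => a | j.+1 => prj1 end.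
exists (IRes de dx), s; split.
  case=> [|[|k]] /=; first by rewrite comp1m.
    by rewrite wab.2 /D /twist prj2_pair.
  by rewrite /D /twist prj2_pair.
exists h; case=> [|[|k]] /=; first by rewrite comp0m addr0 ab.
  by rewrite wab.1 /D /twist prj1_pair addrA compmNl subrr add0r.
by rewrite /D /twist prj1_pair addrA compmNl subrr add0r.
Qed.

End NullHomotopy.

Lemma nullhomotopy M M' (p : ires M) (r : ires M') f :
  @chain_map _ _ 0 p r f ->
  exists (p' : ires M) (s : forall k, hom (p' k) (p k)),
    @chain_map _ _ (idm M) p' p s /\
    exists h : forall k, hom (p' k) (r k.+1), forall k,
      f k \oc s k = (rd r k.+1 : hom (r k.+1) (r k)) \oc h k + hprev M h k \oc rd p' k.
Proof.
move=> fc; have [P [a [b [ab abi abl]]]] :=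
  pullback_exists (rd r 1 : hom (r 1%N) (r 0%N)) (f 0%N).
exact: (nullhomotopy_pullback fc ab abi abl).
Qed.

Lemma epi_to_zero B Z : zero_object Z -> epi (0 : hom B Z).
Proof. by move=> [_ Z0] Y u v _; rewrite (Z0 _ u) (Z0 _ v). Qed.

(* A lift of [u] is a null-homotopy of [- u \oc rd q 0], viewed as a map into the
   acyclic complex [0 <- M' <- r 0 <- r 1 ...]. *)
Lemma lift_resolution M M' (u : hom M M') (q : ires M) (r : ires M') :
  exists (p : ires M) (s : forall k, hom (p k) (q k)) (f : forall k, hom (p k) (r k)),
    @chain_map _ _ (idm M) p q s /\ @chain_map _ _ u p r f.
Proof.
have [Z Z0] := has_zero A.
pose R k : A := match k with 0 => M' | j.+1 => r j end.
pose d k : hom (R k) (aug Z R k) :=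
  match k return hom (R k) (aug Z R k) with
  | 0 => 0 | 1 => - rd r 0 | j.+2 => - rd r j.+1 end.
have de : epi (d 0%N) by apply: epi_to_zero.
have dx k : @exact_el A (R k.+1) (R k) _ (d k.+1) (d k).
  case: k => [|[|k]] /=; last exact: exact_elN (rd_exact r k.+1); last first.
    exact: exact_elN (rd_exact r 0).
  split=> [|T z _]; first exact: comp0m.
  have [T' [t [y [te yE]]]] := epi_local z (@rd_epi _ r).
  by exists T', t, (- y); split=> //; rewrite compmNl compmNr opprK.
pose th k : hom (q k) (R k) := match k with 0 => - (u \oc rd q 0) | j.+1 => 0 end.
have thc : @chain_map _ _ (0 : hom M Z) q (IRes de dx) th.
  case=> [|[|k]] /=; first by rewrite !comp0m.
    by rewrite compm0 compmNl -compmA (rd_rd q 0) compm0 oppr0.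
  by rewrite compm0 comp0m.
have [p [s [sc [h hE]]]] := nullhomotopy thc.
exists p, s, h; split=> //; case=> [|k].
  have := hE 0%N; rewrite /= comp0m addr0 !compmNl => /oppr_inj.
  by rewrite -compmA sc /= comp1m => ->.
have := hE k.+1; rewrite /= comp0m compmNl => /eqP.
by rewrite eq_sym addrC subr_eq0 => /eqP ->.
Qed.

Lemma trivial_resolution M : exists (p : ires M) (s : hom M (p 0%N)),
  rd p 0 \oc s = idm M /\ s \oc rd p 0 = idm (p 0%N).
Proof.
have [Z Z0] := has_zero A.
pose R k : A := match k with 0 => M | j.+1 => Z end.
pose d k : hom (R k) (aug M R k) :=
  match k return hom (R k) (aug M R k) with | 0 => idm M | j.+1 => 0 end.
have de : epi (d 0%N) by apply: epi_id.
have dx k : @exact_el A (R k.+1) (R k) _ (d k.+1) (d k).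
  case: k => [|k] /=; first exact: exact_mono0 (@mono_id _ _).
  by apply: exact_mono0 => T v w _; rewrite (Z0.1 _ v) (Z0.1 _ w).
by exists (IRes de dx), (idm M); rewrite comp1m.
Qed.

Definition cocycle M (p : ires M) n N (g : hom (p n) N) : Prop :=
  g \oc (rd p n.+1 : hom (p n.+1) (p n)) = 0.

(* The class of the cocycle [g] vanishes in [Ext^n(M, N)], viewed as the colimit of
   the n-th cohomology of [Hom(p', N)] over the resolutions [p'] of M. *)
Definition null_class M (p : ires M) n N (g : hom (p n) N) : Prop :=
  exists (p' : ires M) (f : forall k, hom (p' k) (p k)) (s : hom (aug M p' n) N),
    @chain_map _ _ (idm M) p' p f /\ g \oc f n = s \oc rd p' n.

Definition Ext_vanish n M N : Prop := forall (p : ires M) (g : hom (p n) N),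
  cocycle g -> null_class g.

Lemma null_class_push M (p r : ires M) (j : forall k, hom (p k) (r k)) n N
    (g : hom (r n) N) :
  @chain_map _ _ (idm M) p r j -> null_class (g \oc j n) -> null_class g.
Proof.
move=> jc [p' [f [s [fc fE]]]]; exists p', (fun k => j k \oc f k), s.
by split; [rewrite -(comp1m (idm M)); apply: chain_comp fc jc|rewrite compmA].
Qed.

(** Let [g] become a coboundary on [r']. A lift [l] of [u] to [r'], pushed on to [r], and the given
    [j] both lie over [u], so they are homotopic after refinement. As [g] is a cocycle, the homotopy
    alters its pullback only by a coboundary. *)
Lemma null_class_pull M M' (u : hom M M') (p : ires M) (r : ires M')
    (j : forall k, hom (p k) (r k)) n N (g : hom (r n) N) :
  cocycle g -> @chain_map _ _ u p r j -> null_class g -> null_class (g \oc j n).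
Proof.
move=> gc jc [r' [f [s [fc fE]]]].
have [q [t [l [tc lc]]]] := lift_resolution u p r'.
have c1 := chain_comp lc fc; have c2 := chain_comp tc jc.
have c0 : @chain_map _ _ 0 q r (fun k => f k \oc l k - j k \oc t k).
  by have := chain_sub c1 c2; rewrite comp1m compm1 subrr.
have [q' [e [ec [h hE]]]] := nullhomotopy c0.
exists q', (fun k => t k \oc e k), (s \oc augm u l n \oc augm (idm M) e n - g \oc hprev
  M h n).
split; first by have := chain_comp ec tc; rewrite comp1m.
have gE : g \oc (f n \oc l n \oc e n - j n \oc t n \oc e n) =
    g \oc hprev M h n \oc rd q' n.
  by rewrite -compmBl hE [LHS]compmDr compmA gc comp0m add0r compmA.
rewrite compmBl -gE compmBr opprB addrC -addrA.
rewrite !compmA fE -!compmA (congl _ (lc n)) -!compmA ec /=.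
by rewrite addNr addr0.
Qed.

End Resolutions.
Arguments rd_epi {A M} i Z u v.

(** * Exact sequences for Ext *)

Section ExtVanishing.
Local Open Scope ring_scope.
Variable A : abelian_category.
Implicit Types B C D E K L M N P Q T U V W Y Z : A.

Definition copair B C Z (f : hom B Z) (g : hom C Z) : hom (bp B C) Z :=
  f \oc prj1 + g \oc prj2.

Lemma copair_pair B C Z T (f : hom B Z) (g : hom C Z) (x : hom T B) (y : hom T C) :
  copair f g \oc pair x y = f \oc x + g \oc y.
Proof. by rewrite compmDl -!compmA prj1_pair prj2_pair. Qed.

Lemma comp_copair B C Z Y (f : hom B Z) (g : hom C Z) (h : hom Z Y) :
  h \oc copair f g = copair (h \oc f) (h \oc g).
Proof. by rewrite compmDr !compmA. Qed.

Lemma copair_twist B B' C C' Z (b : hom B B') (h : hom C B') (c : hom C C')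
    (f : hom B' Z) (g : hom C' Z) :
  copair f g \oc twist b h c = copair (f \oc b) (f \oc h + g \oc c).
Proof.
by rewrite /copair /twist compmDl -!compmA prj1_pair prj2_pair !compmDr compmDl !compmA
  addrA.
Qed.

Lemma copair_inj1 B C Z (f : hom B Z) (g : hom C Z) : copair f g \oc inj1 = f.
Proof. by rewrite compmDl -!compmA prj1_inj1 prj2_inj1 compm0 addr0 compm1. Qed.

Lemma copair0 B C Z : copair 0 0 = 0 :> hom (bp B C) Z.
Proof. by rewrite /copair !comp0m addr0. Qed.

Lemma twist_twist B2 B1 B0 C2 C1 C0 (b2 : hom B2 B1) (b1 : hom B1 B0)
    (h2 : hom C2 B1) (h1 : hom C1 B0) (c2 : hom C2 C1) (c1 : hom C1 C0) :
  b1 \oc b2 = 0 -> b1 \oc h2 + h1 \oc c2 = 0 -> c1 \oc c2 = 0 ->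
  twist b1 h1 c1 \oc twist b2 h2 c2 = 0.
Proof.
move=> bb bh cc; rewrite {1}/twist pair_comp -!/(copair _ _) copair_twist bb bh.
rewrite copair0 -compmA prj2_pair compmA cc comp0m.
by rewrite /pair !compm0 addr0.
Qed.

(** Yoneda splice at [K]. Degrees shift by conversion, so a cocycle of degree n on a resolution of
    [K] is literally one of degree n + 1 on the spliced resolution of [M]. *)
Definition cons_d E M K (e : hom E M) (k : hom K E) (D : nat -> A)
    (d : forall i, hom (D i) (aug K D i)) i :
    hom (aug E D i) (aug M (aug E D) i) :=
  match i return hom (aug E D i) (aug M (aug E D) i) with
  | 0 => e | 1 => k \oc d 0%N | j.+2 => d j.+1 end.

Section Cons.
Variables (K E M : A) (k : hom K E) (e : hom E M) (ke : ses k e) (p : ires K).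

Lemma cons_exact i : @exact_el A (aug E p i.+1) (aug E p i) _
  (cons_d e k (rd p) i.+1) (cons_d e k (rd p) i).
Proof.
case: i => [|[|i]] /=; last exact: (rd_exact p i.+1).
  by apply: kernel_exact; [case: ke|exact: rd_epi].
by apply/(exact_monol _ _ (ses_mono ke)); apply: (rd_exact p 0).
Qed.

Definition cons_ires : ires M := IRes (ses_epi ke : epi (cons_d e k (rd p) 0))
  cons_exact.
End Cons.

Section Tail.
Variables (M : A) (p : ires M) (K : A) (k : hom K (p 0%N)) (l : hom (p 1%N) K).
Hypotheses (kp : ses k (rd p 0)) (kl : k \oc l = rd p 1).

Definition tail_d (D : nat -> A) (d : forall i, hom (D i) (aug M D i))
    (l' : hom (D 1%N) K) i : hom (D i.+1) (aug K (fun j => D j.+1) i) :=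
  match i return hom (D i.+1) (aug K (fun j => D j.+1) i) with
  | 0 => l' | j.+1 => d j.+2 end.

Lemma tail_epi : epi (tail_d (rd p) l 0).
Proof.
apply: local_epi => T z; have [|T' [t [y [te yE]]]] := (rd_exact p 0).2 _ (k \oc z).
  by rewrite compmA (ses0 kp) comp0m.
by exists T', t, y; split=> //; apply: (ses_mono kp); rewrite !compmA kl yE.
Qed.

Lemma tail_exact i : @exact_el A (p i.+2) (p i.+1) _
  (tail_d (rd p) l i.+1) (tail_d (rd p) l i).
Proof.
case: i => [|i] /=; last exact: (rd_exact p i.+2).
by apply/(exact_monol _ _ (ses_mono kp)); rewrite kl; apply: (rd_exact p 1).
Qed.

Definition tail_ires : ires K := IRes tail_epi tail_exact.
End Tail.

Lemma ses_kernel E M (e : hom E M) : epi e -> exists K (k : hom K E), ses k e.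
Proof. by move=> ee; have [K [k kk]] := has_kernels e; exists K, k. Qed.

Lemma tail_exists M (p : ires M) : exists K (k : hom K (p 0%N)) (l : hom (p 1%N) K),
  ses k (rd p 0) /\ k \oc l = rd p 1.
Proof.
have [K [k kp]] := ses_kernel (@rd_epi _ _ p).
by have [l lE] := ses_lift kp (rd_rd p 0); exists K, k, l.
Qed.

Lemma ses_morph K C M K' C' M' (k : hom K C) (e : hom C M) (k' : hom K' C')
    (e' : hom C' M') (f : hom C C') (u : hom M M') : ses k e -> ses k' e' ->
  e' \oc f = u \oc e -> exists v : hom K K', k' \oc v = f \oc k.
Proof.
move=> ke ke' ef; apply: ses_lift ke' _.
by rewrite compmA ef -compmA (ses0 ke) compm0.
Qed.

Definition cons_map (E : A) (D : nat -> A) (D' : nat -> A) (t : hom E (D' 0%N))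
    (f : forall i, hom (D i) (D' i.+1)) i : hom (aug E D i) (D' i) :=
  match i return hom (aug E D i) (D' i) with 0 => t | j.+1 => f j end.

Lemma cons_map_chain K E M M' (k : hom K E) (e : hom E M) (ke : ses k e) (p : ires K)
    (q : ires M') (u : hom M M') (t : hom E (q 0%N)) (f : forall i, hom (p i) (q i.+1))
      :
  rd q 0 \oc t = u \oc e -> rd q 1 \oc f 0%N = t \oc k \oc rd p 0 ->
  (forall i, (rd q i.+2 : hom (q i.+2) (q i.+1)) \oc f i.+1 = f i \oc rd p i.+1) ->
  @chain_map _ _ _ u (cons_ires ke p) q (cons_map t f).
Proof. by move=> c0 c1 c2 [|[|i]] //=; rewrite c1 compmA. Qed.

(** After refinement [p n] behaves like a projective object. In degree 0 it is replaced by a cover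
    on which [g] lifts, and the new kernel gets a resolution mapping to the old tail; higher degrees
    reduce to this by splitting off the first term. *)
Lemma refine_lift Y Y' (b : hom Y' Y) n M (p : ires M) (g : hom (p n) Y) : epi b ->
  exists (p' : ires M) (f : forall i, hom (p' i) (p i)) (h : hom (p' n) Y'),
    @chain_map _ _ _ (idm M) p' p f /\ b \oc h = g \oc f n.
Proof.
move=> be; elim: n M p g => [|n IHn] M p g; have [K [k [l [kp kl]]]] := tail_exists p.
  have [T [t [y [te yE]]]] := epi_local g be.
  have [K' [k' kp']] := ses_kernel (epi_comp (@rd_epi _ _ p) te).
  have [|v vE] := ses_morph (f := t) (u := idm M) kp' kp; first by rewrite comp1m.
  have [q _] := trivial_resolution K'.
  have [p1 [_ [f [_ fc]]]] := lift_resolution v q (tail_ires kp kl).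
  exists (cons_ires kp' p1), (cons_map (D' := p) t f), y; split=> //.
  apply: cons_map_chain; first by rewrite comp1m.
    have fc0 : l \oc f 0%N = v \oc rd p1 0 := fc 0%N.
    by rewrite -kl -(compmA k) fc0 compmA vE.
  by move=> i; apply: (fc i.+1).
have [p1 [f [h [fc hE]]]] := IHn _ (tail_ires kp kl) g.
exists (cons_ires kp p1), (cons_map (D' := p) (idm _) f), h; split=> //.
apply: cons_map_chain; first by rewrite comp1m compm1.
  have fc0 : l \oc f 0%N = idm K \oc rd p1 0 := fc 0%N.
  by rewrite -kl -(compmA k) fc0 !comp1m.
by move=> i; apply: (fc i.+1).
Qed.

Lemma cocycle_comp M M' (u : hom M M') (p : ires M) (q : ires M') f n N (g : hom (q n)
  N) :
  cocycle g -> @chain_map _ _ _ u p q f -> cocycle (g \oc f n).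
Proof.
move=> gc fc; rewrite /cocycle -compmA.
by have := fc n.+1; rewrite /= => <-; rewrite compmA gc comp0m.
Qed.

(** Exactness of Ext^n(M, Y0) -> Ext^n(M, Y) -> Ext^(n+1)(M, Y1) in the middle. Lift [g] to a
    cochain [h] in [Y0]; its coboundary comes from a cocycle [w] in [Y1], the connecting image. A
    cochain [s] bounding [w] corrects [h] to a cocycle, which is null in turn. *)
Lemma Ext_vanish_coeff n M Y1 Y0 Y (a : hom Y1 Y0) (b : hom Y0 Y) : ses a b ->
  Ext_vanish n M Y0 -> Ext_vanish n.+1 M Y1 -> Ext_vanish n M Y.
Proof.
move=> ab ev0 ev1 p g gc.
have [p' [f [h [fc hE]]]] := refine_lift g (ses_epi ab).
have [w wE] : exists w, a \oc w = h \oc (rd p' n.+1 : hom (p' n.+1) (p' n)).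
  by apply: ses_lift ab _; rewrite compmA hE; apply: (cocycle_comp gc fc).
have [|q [f1 [s [f1c sE]]]] := ev1 p' w.
  apply: (mono0 (ses_mono ab)); rewrite compmA wE -compmA.
  by rewrite (rd_rd p' n.+1) compm0.
have [|r [f2 [t [f2c tE]]]] := ev0 q (h \oc f1 n - a \oc s).
  rewrite /cocycle compmBl -!compmA; have /= <- := f1c n.+1.
  by rewrite compmA -wE -compmA sE subrr.
exists r, (fun k => f k \oc (f1 k \oc f2 k)), (b \oc t); split.
  by have := chain_comp (chain_comp f2c f1c) fc; rewrite !comp1m.
rewrite -compmA -tE compmBl compmBr !compmA (ses0 ab) !comp0m subr0.
by rewrite hE.
Qed.

Lemma Ext_vanish_retract n K C N (i : hom K C) (r : hom C K) :
  r \oc i = idm K -> Ext_vanish n C N -> Ext_vanish n K N.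
Proof.
move=> ri ev p g gc.
have [c0 _] := trivial_resolution C.
have [c [_ [f [_ fc]]]] := lift_resolution r c0 p.
have [q [_ [j [_ jc]]]] := lift_resolution i p c.
apply: (null_class_push (j := fun k => f k \oc j k)).
  by rewrite -ri; apply: chain_comp jc fc.
rewrite compmA; have gfc := cocycle_comp gc fc.
exact: null_class_pull gfc jc (ev _ _ gfc).
Qed.

(* The class of [g] goes to the class of the spliced resolution; a null-homotopy [s]
   of the latter turns [g] into a cocycle on the cone resolving [C]. *)
Lemma Ext_vanish_kernel n K C M N (k : hom K C) (e : hom C M) : ses k e ->
  Ext_vanish n C N -> Ext_vanish n.+1 M N -> Ext_vanish n K N.
Proof.
move=> ke evC evM p g gc.
have [q [f [s [fc sE]]]] := evM (cons_ires ke p) g gc.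
have f0 : e \oc f 0%N = rd q 0 by have := fc 0%N; rewrite /= comp1m.
have f1 : k \oc rd p 0 \oc f 1%N = f 0%N \oc rd q 1 := fc 1%N.
have fS i : (rd p i.+1 : hom (p i.+1) (p i)) \oc f i.+2 = f i.+1 \oc rd q i.+2 :=
  fc i.+2.
(* The mapping cone of [f], acyclic because source and target both resolve [M]. Its last term is the
   unpaired [C], so the others form a resolution of [C]. *)
pose R i := bp (p i) (q i).
pose d i : hom (R i) (aug C R i) :=
  match i return hom (R i) (aug C R i) with
  | 0 => copair (k \oc rd p 0) (f 0%N)
  | j.+1 => twist (rd p j.+1 : hom (p j.+1) (p j)) (f j.+1 : hom (q j.+1) (p j)) (- rd
    q j.+1)
  end.
have de : epi (d 0%N).
  apply: local_epi => T z.
  have [T1 [t1 [y [t1e yE]]]] := epi_local (e \oc z) (@rd_epi _ _ q).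
  have [|w wE] := ses_lift (z := z \oc t1 - f 0%N \oc y) ke.
    by rewrite compmBr !compmA f0 yE subrr.
  have [T2 [t2 [x [t2e xE]]]] := epi_local w (@rd_epi _ _ p).
  exists T2, (t1 \oc t2), (pair x (y \oc t2)); split; first exact: epi_comp.
  by rewrite copair_pair -compmA xE compmA wE compmBl !compmA addrNK.
have dx i : @exact_el A (R i.+1) (R i) _ (d i.+1) (d i).
  case: i => [|i] /=.
    apply: (exact_twist (b1 := k \oc rd p 0) (h1 := f 0%N) (c1 := - rd q 0)).
    - exact: (proj1 (exact_monol _ _ (ses_mono ke)) (rd_exact p 0)).
    - exact: exact_elN (rd_exact q 0).
    - by rewrite f1 compmNr subrr.
    - rewrite copair_twist f1 compmNr subrr -compmA (rd_rd p 0) compm0.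
      exact: copair0.
    - move=> Z x y; rewrite copair_pair => xy; split=> //.
      have := congr1 (fun z => e \oc z) xy; rewrite compmDr !compmA (ses0 ke) f0.
      by rewrite !comp0m add0r compm0 compmNl => ->; rewrite oppr0.
  apply: (exact_twist (h1 := f i.+1 : hom (q i.+1) (p i)) (rd_exact p i.+1) (exact_elN
    (rd_exact q i.+1))).
  - by rewrite fS compmNr subrr.
  - apply: twist_twist; first exact: (rd_rd p i.+1).
      by rewrite fS compmNr subrr.
    by rewrite compmNl compmNr (rd_rd q i.+1) !oppr0.
  - move=> Z x y; rewrite twist_pair => xy; split.
      by have := congr1 (fun z => prj2 \oc z) xy; rewrite prj2_pair compm0.
    by have := congr1 (fun z => prj1 \oc z) xy; rewrite prj1_pair compm0.
pose r := IRes de dx.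
have cc : cocycle (p := r) (n := n) (copair g s).
  rewrite /cocycle /= copair_twist gc compmNr; move: sE => /= ->.
  by rewrite subrr; apply: copair0.
have jc : @chain_map _ _ _ k p r (fun i => inj1).
  case=> [|i] /=; first by rewrite copair_inj1.
  apply: pair_ext; rewrite !compmA ?prj1_pair ?prj2_pair.
    by rewrite prj1_inj1 comp1m -/(copair _ _) copair_inj1.
  rewrite [in RHS]prj2_inj1 comp0m -compmA prj2_inj1. exact: compm0.
have := null_class_pull cc jc (evC _ _ cc).
by rewrite copair_inj1.
Qed.

(** Exactness of Ext^(n+1)(K, N) -> Ext^(n+2)(M, N) -> Ext^(n+2)(C, N) in the middle. With [phi]
    over [kp] and [psi] over [pi], the composite lies over 0 and has a null-homotopy [h]. If [s]
    bounds the pullback of [g] to [C], then [s \oc phi n.+1 - g \oc h n.+1] is a cocycle for [K],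
    bounded by some [t] after refinement. *)
Lemma Ext_vanish_cokernel n K C M N (kp : hom K C) (pi : hom C M) : ses kp pi ->
  Ext_vanish n.+1 K N -> Ext_vanish n.+2 C N -> Ext_vanish n.+2 M N.
Proof.
move=> kpi evK evC p g gc.
have [c1 _] := trivial_resolution C.
have [c0 [_ [psi0 [_ psi0c]]]] := lift_resolution pi c1 p.
have [c [f [s [fc sE]]]] := evC _ _ (cocycle_comp gc psi0c).
have := chain_comp fc psi0c; rewrite compm1.
move: sE; rewrite -compmA; set psi := fun i => psi0 i \oc f i.
rewrite -/(psi n.+2) => sE psic.
have [k2 _] := trivial_resolution K.
have [k0 [_ [phi0 [_ phi0c]]]] := lift_resolution kp k2 c.
have c0' : @chain_map _ _ _ 0 k0 p (fun i => psi i \oc phi0 i).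
  by rewrite -(ses0 kpi); apply: chain_comp phi0c psic.
have [k1 [sg [sgc [h0 h0E]]]] := nullhomotopy c0'.
have := chain_comp sgc phi0c; rewrite compm1; set phi1 := fun i => _ => phi1c.
have phi1E i : psi i \oc phi1 i = (rd p i.+1 : hom (p i.+1) (p i)) \oc h0 i + hprev K
  h0 i \oc rd k1 i.
  by rewrite /phi1 compmA h0E.
have [|k [f2 [t [f2c tE]]]] := evK k1 (s \oc phi1 n.+1 - g \oc h0 n.+1).
  rewrite /cocycle compmBl -(compmA s) -(compmA g).
  have /= <- := phi1c n.+2; rewrite (compmA s) -sE -compmA phi1E [g \oc (_ + _)]compmDr.
  by rewrite compmA gc comp0m add0r subrr.
have := chain_comp f2c phi1c; rewrite compm1; set phi := fun i => _ => phic.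
pose h i := h0 i \oc f2 i.
have hE i : psi i \oc phi i = (rd p i.+1 : hom (p i.+1) (p i)) \oc h i + hprev K h i
  \oc rd k i.
  rewrite /phi compmA phi1E compmDl -!compmA f2c; congr (_ + _).
  by case: i => [|i] /=; rewrite ?comp0m // compmA.
have tE' : s \oc phi n.+1 - g \oc h n.+1 = t \oc rd k n.+1.
  by rewrite -tE compmBl -(compmA s) -(compmA g).
clearbody phi psi h.
(* The cone of [phi], which resolves the cokernel [M] of [kp]. The pair [(psi, h)] maps it to [p]
   over the identity, and [(s, t)] bounds the pullback of [g]. *)
pose E i := match i with 0 => c 0%N | j.+1 => bp (c j.+1) (k j) end.
pose D i : hom (bp (c i.+2) (k i.+1)) (bp (c i.+1) (k i)) :=
  twist (rd c i.+2 : hom (c i.+2) (c i.+1)) (phi i.+1) (- rd k i.+1 : hom (k i.+1) (k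
    i)).
pose d i : hom (E i) (aug M E i) :=
  match i return hom (E i) (aug M E i) with
  | 0 => pi \oc rd c 0 | 1 => copair (rd c 1) (phi 0%N) | j.+2 => D j end.
have phi0E : rd c 0 \oc phi 0%N = kp \oc rd k 0 := phic 0%N.
have phiSE i : (rd c i.+1 : hom (c i.+1) (c i)) \oc phi i.+1 = phi i \oc rd k i.+1 :=
  phic i.+1.
have de : epi (d 0%N) by apply: epi_comp; [exact: ses_epi kpi|exact: rd_epi].
have dx i : @exact_el A (E i.+1) (E i) _ (d i.+1) (d i).
  case: i => [|[|i]] /=.
  - split.
      rewrite comp_copair -!compmA phi0E (rd_rd c 0) compm0 compmA (ses0 kpi) comp0m.
      exact: copair0.
    move=> T z; rewrite -compmA => /(ses_lift kpi) [w wE].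
    have [T1 [t1 [y [t1e yE]]]] := epi_local w (@rd_epi _ _ k).
    have [|T2 [t2 [x [t2e xE]]]] := (rd_exact c 0).2 _ (z \oc t1 - phi 0%N \oc y).
      by rewrite compmBr !compmA phi0E -wE -!compmA yE subrr.
    exists T2, (t1 \oc t2), (pair x (y \oc t2)); split; first exact: epi_comp.
    by rewrite copair_pair xE compmBl -!compmA addrNK.
  - apply: (exact_twist (h1 := phi 0%N) (rd_exact c 1) (exact_elN (rd_exact k 0))).
    + by rewrite phiSE compmNr subrr.
    + rewrite copair_twist (rd_rd c 1) phiSE compmNr subrr; exact: copair0.
    + move=> Z x y; rewrite copair_pair => xy; split=> //.
      have := congr1 (fun z => rd c 0 \oc z) xy;
        rewrite compmDr !compmA (rd_rd c 0) phi0E.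
      rewrite !comp0m add0r compm0 -compmA => /(mono0 (ses_mono kpi)) y0.
      by rewrite compmNl y0 oppr0.
  - apply: (exact_twist (h1 := phi i.+1) (rd_exact c i.+2) (exact_elN (rd_exact k
    i.+1))).
    + by rewrite phiSE compmNr subrr.
    + apply: twist_twist; first exact: (rd_rd c i.+2).
        by rewrite phiSE compmNr subrr.
      by rewrite compmNl compmNr (rd_rd k i.+1) !oppr0.
    + move=> Z x y; rewrite twist_pair => xy; split.
        by have := congr1 (fun z => prj2 \oc z) xy; rewrite prj2_pair compm0.
      by have := congr1 (fun z => prj1 \oc z) xy; rewrite prj1_pair compm0.
pose F i : hom (E i) (p i) :=
  match i return hom (E i) (p i) with
  | 0 => psi 0%N | j.+1 => copair (psi j.+1) (h j) end.
exists (IRes de dx), F, (copair s t); split.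
  case=> [|[|i]] /=; first by rewrite comp1m (psic 0%N).
    rewrite !comp_copair (psic 1%N) /=.
    by rewrite hE /= comp0m addr0.
  rewrite comp_copair copair_twist (psic i.+2) hE compmNr.
  by rewrite addrK.
rewrite /= comp_copair copair_twist sE compmNr -tE' opprB.
by rewrite addrC addrNK.
Qed.

End ExtVanishing.

(** * Comparison with Yoneda extensions *)

Section Opposite.
Local Open Scope ring_scope.
Variable A : abelian_category.

Definition op_preadditive : preadditive_category :=
  @Preadditive A (fun B C => hom C B) (@idm A) (fun B C D g f => f \oc g)
    (fun B C D E h g f => esym (compmA f g h)) (fun B C f => compm1 f)
    (fun B C f => comp1m f) (fun B C D g h f => compmDr f g h)
    (fun B C D g f h => compmDl f h g).

Lemma op_zero : exists Z : op_preadditive, zero_object Z.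
Proof. by have [Z [Z1 Z2]] := has_zero A; exists Z; split. Qed.

Lemma op_biproducts (B C : op_preadditive) : exists S, biproduct B C S.
Proof.
have [S [i [j [p [q [e1 e2 e3 e4 e5]]]]]] := has_biproducts (B : A) (C : A).
by exists S, p, q, i, j.
Qed.

Lemma op_mono_kernel (B C : op_preadditive) (f : hom B C) : mono f ->
  exists (D : op_preadditive) (g : hom C D), is_kernel g f.
Proof. exact: (@epi_is_cokernel A C B f). Qed.

Lemma op_epi_cokernel (B C : op_preadditive) (f : hom B C) : epi f ->
  exists (D : op_preadditive) (g : hom D B), is_cokernel g f.
Proof. exact: (@mono_is_kernel A C B f). Qed.

(** Kernels in the opposite category unfold to cokernels in [A], so the axioms of [A] serve as they
    stand. Only [ses], phrased by a kernel and an epi, is not self-dual by conversion; [op_ses]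
    bridges this. *)
Definition op : abelian_category :=
  @Abelian op_preadditive op_zero op_biproducts
    (fun B C f => @has_cokernels A C B f) (fun B C f => @has_kernels A C B f)
    op_mono_kernel op_epi_cokernel.

Lemma op_ses (B C D : A) (f : hom B C) (g : hom C D) :
  @ses op D C B g f <-> ses f g.
Proof.
split=> [[c m]|s]; first exact: coker_ses.
by split; [exact: (ses_coker s)|exact: (ses_mono s)].
Qed.

End Opposite.

(** * Pullbacks, pushouts and composites of short exact sequences *)

Section Squares.
Local Open Scope ring_scope.
Variable A : abelian_category.
Implicit Types B C D E K L M N P Q T U V W Y Z : A.

Lemma ses_pullback K C M (k : hom K C) (e : hom C M) M' (u : hom M' M) : ses k e ->
  exists P (a : hom P C) (b : hom P M') (k' : hom K P),
    [/\ ses k' b, a \oc k' = k, e \oc a = u \oc b &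
    (forall Z (v w : hom Z P), a \oc v = a \oc w -> b \oc v = b \oc w -> v = w) /\
    (forall Z (v : hom Z C) (w : hom Z M'), e \oc v = u \oc w ->
      exists x : hom Z P, a \oc x = v /\ b \oc x = w)].
Proof.
move=> ke; have [P [a [b [ab inj lift]]]] := pullback_exists e u.
have [|k' [ak' bk']] := lift _ k 0; first by rewrite (ses0 ke) compm0.
exists P, a, b, k'; split=> //; split.
  apply/is_kernelP; split=> //.
    by apply: (@mono_of_comp _ _ _ _ a); rewrite ak'; apply: ses_mono ke.
  move=> Z z bz; have [|h hE] := ses_lift (z := a \oc z) ke.
    by rewrite compmA ab -compmA bz compm0.
  by exists h; apply: inj; rewrite compmA ?ak' ?bk' ?hE// comp0m bz.
exact: epi_pullback ab lift (ses_epi ke).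
Qed.

Lemma ses_pullback2 K C M L C' (k : hom K C) (e : hom C M) (l : hom L C') (d : hom C'
  M) :
  ses k e -> ses l d ->
  exists P (a : hom P C) (b : hom P C') (k' : hom K P) (l' : hom L P),
    ses k' b /\ ses l' a.
Proof.
move=> ke ld; have [P [a [b [k' [kb ak ab [inj lift]]]]]] := ses_pullback d ke.
have [|l' [al bl]] := lift _ 0 l; first by rewrite (ses0 ld) compm0.
exists P, a, b, k', l'; split=> //; split; last first.
  apply: (@epi_pullback _ _ _ _ _ d e b a) (ses_epi ld) => // Z u v uv.
  by have [x [x1 x2]] := lift _ v u (esym uv); exists x.
apply/is_kernelP; split=> //.
  by apply: (@mono_of_comp _ _ _ _ b); rewrite bl; apply: ses_mono ld.
move=> Z z az; have [|h hE] := ses_lift (z := b \oc z) ld.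
  by rewrite compmA -ab -compmA az compm0.
by exists h; apply: inj; rewrite compmA ?al ?bl ?hE// comp0m az.
Qed.

Lemma ses_comp_epi K C M L E (k : hom K C) (e : hom C M) (l : hom L E) (d : hom E C) :
  ses k e -> ses l d ->
  exists P (i : hom P E) (q : hom P K) (l' : hom L P), ses i (e \oc d) /\ ses l' q.
Proof.
move=> ke ld; have ede := epi_comp (ses_epi ke) (ses_epi ld).
have [P [i ie]] := ses_kernel ede.
have [|q qE] := ses_lift (z := d \oc i) ke; first by rewrite compmA (ses0 ie).
have [|l' lE] := ses_lift (z := l) ie; first by rewrite -compmA (ses0 ld) compm0.
exists P, i, q, l'; split=> //; split; last first.
  apply: local_epi => T z; have [T' [t [y [te yE]]]] :=
    epi_local (k \oc z) (ses_epi ld).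
  have [|w wE] := ses_lift (z := y) ie.
    by rewrite -compmA yE !compmA (ses0 ke) !comp0m.
  exists T', t, w; split=> //; apply: (ses_mono ke).
  by rewrite !compmA qE -compmA wE.
apply/is_kernelP; split=> //.
- by apply: (ses_mono ke); rewrite compmA qE -compmA lE (ses0 ld) compm0.
- by apply: (@mono_of_comp _ _ _ _ i); rewrite lE; apply: ses_mono ld.
move=> Z z qz; have [|h hE] := ses_lift (z := i \oc z) ld.
  by rewrite compmA -qE -compmA qz compm0.
by exists h; apply: (ses_mono ie); rewrite compmA lE.
Qed.

End Squares.

Section Pushouts.
Local Open Scope ring_scope.
Variable A : abelian_category.
Implicit Types B C D E K L M N P Q T U V W Y Z : A.

Lemma ses_pushout K C M (k : hom K C) (e : hom C M) N (v : hom K N) : ses k e ->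
  exists Q (a : hom C Q) (b : hom N Q) (e' : hom Q M),
    [/\ ses b e', e' \oc a = e, a \oc k = b \oc v &
    (forall Z (x y : hom Q Z), x \oc a = y \oc a -> x \oc b = y \oc b -> x = y) /\
    (forall Z (x : hom C Z) (y : hom N Z), x \oc k = y \oc v ->
      exists w : hom Q Z, w \oc a = x /\ w \oc b = y)].
Proof.
move/op_ses => s; have [Q [a [b [e' [s' h1 h2 [h3 h4]]]]]] :=
  @ses_pullback (op A) _ _ _ _ _ _ v s.
by exists Q, a, b, e'; split=> //; apply/op_ses.
Qed.

Lemma ses_pushout2 K C M C' L (k : hom K C) (e : hom C M) (l : hom K C') (d : hom C' L)
  :
  ses k e -> ses l d ->
  exists Q (a : hom C Q) (b : hom C' Q) (e' : hom Q M) (d' : hom Q L),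
    ses b e' /\ ses a d'.
Proof.
move=> /op_ses s /op_ses s'.
have [Q [a [b [e' [d' [/op_ses h1 /op_ses h2]]]]]] :=
  @ses_pullback2 (op A) _ _ _ _ _ _ _ _ _ s s'.
by exists Q, a, b, e', d'.
Qed.

Lemma ses_comp_mono L K N C M (l : hom L K) (d : hom K N) (k : hom K C) (e : hom C M) :
  ses l d -> ses k e ->
  exists W (q : hom C W) (i : hom N W) (p : hom W M), ses (k \oc l) q /\ ses i p.
Proof.
move=> /op_ses s /op_ses s'.
have [Q [a [b [e' [/op_ses h1 /op_ses h2]]]]] :=
  @ses_comp_epi (op A) _ _ _ _ _ _ _ _ _ s s'.
by exists Q, a, b, e'.
Qed.

Lemma exact_desc B C D E (f : hom B C) (g : hom C D) (x : hom C E) :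
  exact_el f g -> epi g -> x \oc f = 0 -> exists y, y \oc g = x.
Proof.
move=> [_ fl] ge xf; have [K [k kg]] := ses_kernel ge.
apply: (ses_desc kg); have [T [t [y [te yE]]]] := fl _ _ (ses0 kg).
by apply: (epi0 te); rewrite -compmA -yE compmA xf comp0m.
Qed.

End Pushouts.

(** * Cocycles and Yoneda extensions *)

Section YonedaExt.
Local Open Scope ring_scope.
Variable A : abelian_category.
Implicit Types B C D E K L M N P Q T U V W Y Z : A.

(** The conditions stop at degree n because the terms of an extension beyond n are arbitrary. *)
Definition to_extension n M N L (u : hom L M) (p : ires L) (e : extension n M N)
    (f : forall k, hom (p k) (ext_ob e k)) : Prop :=
  forall k, (k <= n)%N -> ext_diff e k \oc f k = augm u f k \oc rd p k.

Definition extension_map n M N M' N' (u : hom M M') (e : extension n M N)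
    (e' : extension n M' N') (f : forall k, hom (ext_ob e k) (ext_ob e' k)) : Prop :=
  forall k, (k <= n)%N -> ext_diff e' k \oc f k = augm u f k \oc ext_diff e k.

Lemma ext_epi n M N (e : extension n M N) : epi (ext_diff e 0).
Proof. by case: (ext_exact e). Qed.

Lemma ext_mono n M N (e : extension n M N) : mono (ext_inj e).
Proof. by case: (ext_exact e). Qed.

Lemma ext_exact_inj n M N (e : extension n M N) : exact_el (ext_inj e) (ext_diff e n).
Proof. by apply/exact_atP; case: (ext_exact e). Qed.

Lemma ext_exact_mid n M N (e : extension n M N) k : (k < n)%N ->
  @exact_el A (ext_ob e k.+1) (ext_ob e k) _ (ext_diff e k.+1) (ext_diff e k).
Proof. by move=> kn; apply/exact_atP; case: (ext_exact e) => _ h _ _; apply: h. Qed.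

Lemma ext_ses M N (e : extension 0 M N) : ses (ext_inj e) (ext_diff e 0).
Proof. apply: sesP; [exact: ext_mono|exact: ext_epi|exact: ext_exact_inj]. Qed.

Arguments ext_epi {n M N} e Z u v.
Arguments ext_mono {n M N} e Z u v.

Section TailExtension.
Variables (n : nat) (M N : A) (e : extension n.+1 M N) (K : A).
Variables (k : hom K (ext_ob e 0)) (l : hom (ext_ob e 1) K).
Hypotheses (kp : ses k (ext_diff e 0)) (kl : k \oc l = ext_diff e 1).

Lemma tail_ext_exact : @exact_sequence A n N K (fun j => ext_ob e j.+1)
  (tail_d (ext_diff e) l) (ext_inj e).
Proof.
split.
- apply: local_epi => T z.
  have [|T' [t [y [te yE]]]] := (ext_exact_mid e (ltn0Sn n)).2 _ (k \oc z).
    by rewrite compmA (ses0 kp) comp0m.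
  by exists T', t, y; split=> //; apply: (ses_mono kp); rewrite !compmA kl yE.
- move=> [|j] jn; apply/exact_atP; last exact: (@ext_exact_mid _ _ _ e j.+2).
  by apply/(exact_monol _ _ (ses_mono kp)); rewrite kl;
    apply: (@ext_exact_mid _ _ _ e 1).
- apply/exact_atP; case: n e l k kp kl => [|m] e' l' k' kp' kl' /=;
  last exact: ext_exact_inj.
  by apply/(exact_monol _ _ (ses_mono kp')); rewrite kl'; apply: ext_exact_inj.
- exact: ext_mono.
Qed.

Definition tail_ext : extension n K N := Extension tail_ext_exact.
End TailExtension.

Lemma tail_ext_exists n M N (e : extension n.+1 M N) :
  exists K (k : hom K (ext_ob e 0)) (l : hom (ext_ob e 1) K),
  ses k (ext_diff e 0) /\ k \oc l = ext_diff e 1.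
Proof.
have [K [k kp]] := ses_kernel (ext_epi e).
have [|l lE] := ses_lift (z := ext_diff e 1) kp;
  first by case: (ext_exact_mid e (ltn0Sn n)).
by exists K, k, l.
Qed.

Section ConsExtension.
Variables (n : nat) (M N K E : A) (k : hom K E) (d : hom E M) (kd : ses k d).
Variable e : extension n K N.

Lemma cons_ext_exact : @exact_sequence A n.+1 N M (aug E (ext_ob e))
  (cons_d d k (ext_diff e)) (ext_inj e).
Proof.
split; [exact: ses_epi kd| |  |exact: ext_mono].
- move=> [|[|j]] jn /=; apply/exact_atP; last exact: (@ext_exact_mid _ _ _ e j.+1).
    by apply: kernel_exact; [case: kd|exact: ext_epi].
  by apply/(exact_monol _ _ (ses_mono kd)); apply: (@ext_exact_mid _ _ _ e 0).
- apply/exact_atP; case: n e => [|m] e' /=; last exact: ext_exact_inj.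
  by apply/(exact_monol _ _ (ses_mono kd)); apply: ext_exact_inj.
Qed.

Definition cons_ext : extension n.+1 M N := Extension cons_ext_exact.
End ConsExtension.

(** The resolution is [e] continued by the trivial resolution of [N], so [g] is essentially the
    identity of [N]. By the second clause every map of a resolution into [e] extends to it; [u] is
    arbitrary there because passing to kernels turns the identity of [M] into other maps. *)
Lemma extension_resolution n M N (e : extension n M N) :
  exists (r : ires M) (g : hom (r n.+1) N),
    (exists f, @to_extension _ _ _ _ (idm M) r e f /\
       ext_inj e \oc g = f n \oc (rd r n.+1 : hom (r n.+1) (r n))) /\
    forall L (u : hom L M) (p : ires L) f, @to_extension _ _ _ _ u p e f ->
      exists phi, @chain_map _ _ _ u p r phi /\
        ext_inj e \oc (g \oc phi n.+1) = f n \oc (rd p n.+1 : hom (p n.+1) (p n)).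
Proof.
elim: n M e => [|n IHn] M e.
  have [t [s [ts st]]] := trivial_resolution N.
  have ie := ext_ses e.
  exists (cons_ires ie t), (rd t 0); split.
    exists (fun k => match k return hom (cons_ires ie t k) (ext_ob e k) with
      | 0 => idm _ | j.+1 => 0 end); split; last by rewrite /= comp1m.
    by case=> // _; rewrite /= compm1 comp1m.
  move=> L u p f fe; have f0 := fe 0%N (leqnn 0).
  have [|w wE] := ses_lift (z := f 0%N \oc rd p 1) ie.
    by rewrite compmA f0 -compmA (rd_rd p 0) compm0.
  pose phi k : hom (p k) (cons_ires ie t k) :=
    match k return hom (p k) (cons_ires ie t k) with
    | 0 => f 0%N | 1 => s \oc w | j.+2 => 0 end.
  exists phi; split; last by rewrite /= (compmA _ s) ts comp1m.
  case=> [|[|[|k]]] //=.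
  - by rewrite -(compmA _ (rd t 0)) (compmA _ s) ts comp1m.
  - rewrite compm0 -compmA; have -> : w \oc (rd p 2 : hom (p 2%N) (p 1%N)) = 0.
      by apply: (mono0 (ext_mono e)); rewrite compmA wE -compmA (rd_rd p 1) compm0.
    by rewrite compm0.
  - by rewrite compm0 comp0m.
have [K [k [l [ke kl]]]] := tail_ext_exists e.
have [r [g [[f [fe fE]] up]]] := IHn _ (tail_ext ke kl).
exists (cons_ires ke r), g; split.
  exists (cons_map (D' := ext_ob e) (idm _) f); split=> //.
  case=> [|[|j]] jn /=; first by rewrite comp1m compm1.
    have f0 : l \oc f 0%N = idm K \oc rd r 0 := fe 0%N isT.
    by rewrite -kl -(compmA k) f0 !comp1m.
  exact: (fe j.+1).
move=> L u p f0 f0e.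
have [Kp [kp [lp [kpp kpl]]]] := tail_exists p.
have f00 := f0e 0%N isT; have [v vE] := ses_morph kpp ke f00.
have f01 : ext_diff e 1 \oc f0 1%N = f0 0%N \oc rd p 1 := f0e 1%N isT.
have [|phi [phic phiE]] := up _ v (tail_ires kpp kpl) (fun j => f0 j.+1).
  case=> [|j] jn; last exact: (f0e j.+2).
  apply: (ses_mono ke) => /=; rewrite !compmA kl vE.
  by rewrite -(compmA (f0 0%N)) kpl.
exists (fun j => match j return hom (p j) (cons_ires ke r j) with
  | 0 => f0 0%N | i.+1 => phi i end); split=> //.
case=> [|[|j]] //=; last exact: (phic j.+1).
have phi0 : rd r 0 \oc phi 0%N = v \oc lp := phic 0%N.
by rewrite -(compmA k) phi0 compmA vE -compmA kpl.
Qed.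

(** For n = 0 this is the pushout of [0 -> K -> p 0 -> M -> 0] along the map [K -> N] induced by the
    cocycle; for larger n it is spliced behind the first terms of [p]. The cochain [s] allows a
    comparison of cocycles up to coboundaries. *)
Lemma cocycle_extension n M (p : ires M) N (g : hom (p n.+1) N) : cocycle g ->
  exists e : extension n M N,
    (exists f, @to_extension _ _ _ _ (idm M) p e f /\
       ext_inj e \oc g = f n \oc (rd p n.+1 : hom (p n.+1) (p n))) /\
    forall M' (u : hom M M') (e' : extension n M' N) f (s : hom (p n) N),
      @to_extension _ _ _ _ u p e' f ->
      ext_inj e' \oc (g + s \oc (rd p n.+1 : hom (p n.+1) (p n))) = f n \oc rd p n.+1 ->
      exists F, @extension_map _ _ _ _ _ u e e' F /\ F n \oc ext_inj e = ext_inj e'.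
Proof.
elim: n M p g => [|n IHn] M p g gc; have [K [k [l [kp kl]]]] := tail_exists p.
  have le : epi l := rd_epi (tail_ires kp kl).
  have [v vE] : exists v, v \oc l = g by apply: exact_desc (rd_exact (tail_ires kp kl)
    0) le gc.
  have [Q [a [b [d [bd da akbv [jep desc]]]]]] := ses_pushout v kp.
  pose dd j : hom Q (aug M (fun=> Q) j) :=
    match j return hom Q (aug M (fun=> Q) j) with 0 => d | i.+1 => 0 end.
  have ex : @exact_sequence A 0 N M (fun=> Q) dd b.
    split=> //; [exact: ses_epi bd| |exact: ses_mono bd].
    by apply/exact_atP; apply: ses_exact.
  exists (Extension ex); split.
    exists (fun j => match j return hom (p j) Q with 0 => a | i.+1 => 0 end); split.
      by case=> // _; rewrite /= comp1m.
    by rewrite /= -vE -kl !compmA akbv.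
  move=> M' u e' f s fe fE.
  have f0 := fe 0%N isT.
  (* The map out of the pushout is [f 0] corrected by [s] on [p 0], and the inclusion on [N]; the
     two agree on [K] by [fE]. *)
  have [|w [wa wb]] := desc _ (f 0%N - ext_inj e' \oc s) (ext_inj e').
    apply: le; rewrite -!compmA vE compmBl -!compmA kl.
    have := fE; rewrite compmDr compmA => <-.
    by rewrite -!compmA addrK.
  exists (fun j => match j return hom Q (ext_ob e' j) with 0 => w | i.+1 => 0 end).
  split=> //; case=> // _ /=; apply: jep.
    rewrite -!compmA wa da compmBr f0 compmA (ext_exact_inj e').1.
    by rewrite comp0m subr0.
  by rewrite -!compmA wb (ses0 bd) (ext_exact_inj e').1 compm0.
have [e [[f [fe fE]] up]] := IHn _ (tail_ires kp kl) g gc.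
exists (cons_ext kp e); split.
  exists (fun j => match j return hom (p j) (aug (p 0%N) (ext_ob e) j) with
    | 0 => idm _ | i.+1 => f i end); split=> //.
  case=> [|[|j]] jn /=; first by rewrite comp1m compm1.
    have f0 : ext_diff e 0 \oc f 0%N = idm K \oc l := fe 0%N isT.
    by rewrite -(compmA k) f0 !comp1m.
  exact: (fe j.+1).
move=> M' u e' f0 s f0e f0E.
have [K' [k' [l' [kp' kl']]]] := tail_ext_exists e'.
have [v vE] := ses_morph kp kp' (f0e 0%N isT).
have f01 : ext_diff e' 1 \oc f0 1%N = f0 0%N \oc rd p 1 := f0e 1%N isT.
have [|F [Fe FE]] := up _ v (tail_ext kp' kl') (fun j => f0 j.+1) s _ f0E.
  case=> [|j] jn; last exact: (f0e j.+2).
  apply: (ses_mono kp') => /=; rewrite !compmA kl' vE.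
  by rewrite -(compmA (f0 0%N)) kl.
exists (cons_map (D' := ext_ob e') (f0 0%N) F); split=> //.
case=> [|[|j]] jn /=; first exact: (f0e 0%N isT).
  have F0 : l' \oc F 0%N = v \oc ext_diff e 0 := Fe 0%N isT.
  by rewrite -kl' -(compmA k') F0 !compmA vE.
exact: (Fe j.+1).
Qed.

Lemma extension_mapP n M N (e e' : extension n M N) : extension_morphism e e' <->
  exists F, @extension_map _ _ _ _ _ (idm M) e e' F /\ F n \oc ext_inj e = ext_inj e'.
Proof.
by split=> -[F [h1 h2]]; exists F; split=> // k kn; rewrite (h1 k kn); case: k {kn}.
Qed.

(** Nullity of the class of [e], measured on [e] itself: a cocycle [g] with
    [ext_inj e \oc g = f n \oc rd p n.+1] is the coboundary of [s]. *)
Definition null_extension n M N (e : extension n M N) : Prop :=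
  exists (p : ires M) f (s : hom (p n) N), @to_extension _ _ _ _ (idm M) p e f /\
    f n \oc (rd p n.+1 : hom (p n.+1) (p n)) = ext_inj e \oc s \oc rd p n.+1.

Lemma null_extension_class n M N (e : extension n M N) (r : ires M) (g : hom (r n.+1)
  N) f :
  @to_extension _ _ _ _ (idm M) r e f ->
  ext_inj e \oc g = f n \oc (rd r n.+1 : hom (r n.+1) (r n)) ->
  null_extension e <-> null_class g.
Proof.
move=> fe fE; split.
  move=> [p [f' [s [f'e f'E]]]].
  have [r0 [g0 [[f0 [f0e f0E]] up]]] := extension_resolution e.
  have [phi [phic phiE]] := up _ _ _ _ f'e.
  have n0 : null_class g0.
    exists p, phi, s; split=> //; apply: (ext_mono e); rewrite phiE f'E -compmA.
    by [].
  have g0c : cocycle g0.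
    apply: (mono0 (ext_mono e)); rewrite compmA f0E -compmA.
    by rewrite (rd_rd r0 n.+1) compm0.
  have [psi [psic psiE]] := up _ _ _ _ fe.
  have -> : g = g0 \oc psi n.+1 by apply: (ext_mono e); rewrite psiE.
  exact: null_class_pull psic n0.
move=> [p [f' [s [f'c f'E]]]]; exists p, (fun k => f k \oc f' k), s; split.
  move=> k kn; rewrite compmA fe // -compmA f'c compmA.
  by case: k {kn} => [|k]; rewrite ?comp1m.
have /= := f'c n.+1; rewrite -(compmA (f n)) => <-.
by rewrite compmA -fE -!compmA f'E.
Qed.

Lemma null_extension_equiv n M N (e e' : extension n M N) :
  Yoneda_equiv e e' -> null_extension e <-> null_extension e'.
Proof.
elim=> {e e'} [e e' /extension_mapP [F [Fe FE]]|e|e e' _ ih|e1 e2 e3 _ ih1 _ ih2].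
- have [r [g [[f [fe fE]] _]]] := extension_resolution e.
  rewrite (null_extension_class fe fE).
  symmetry; apply: (@null_extension_class _ _ _ e' r g (fun k => F k \oc f k)).
    move=> k kn; rewrite compmA Fe // -compmA fe // compmA.
    by case: k {kn} => [|k]; rewrite ?comp1m.
  by rewrite -FE -!compmA fE.
- by [].
- by symmetry.
- by rewrite ih1.
Qed.

(** Left to right, the extension built from [g] is equivalent to one built from the zero cocycle,
    and nullity is invariant. Right to left, the extension built from the zero cocycle on a common
    refinement maps to both [e1] and [e2], so one roof connects them. *)
Lemma Ext_eq0P n M N : Ext_eq0 n.+1 M N <-> Ext_vanish n.+1 M N.
Proof.
split=> [ext0 p g gc|ev e1 e2].
  have [e [[f [fe fE]] _]] := cocycle_extension gc.
  have gc0 : cocycle (0 : hom (p n.+1) N) by apply: comp0m.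
  have [e0 [[f0 [f0e f0E]] _]] := cocycle_extension gc0.
  apply/(null_extension_class fe fE).
  apply/(null_extension_equiv (ext0 e e0)).
  exists p, f0, 0; split=> //.
  by rewrite -f0E !compm0 comp0m.
have nullE e : exists (p : ires M) f (s : hom (p n) N), @to_extension _ _ _ _ (idm M) p
  e f /\
    ext_inj e \oc (s \oc rd p n.+1) = f n \oc (rd p n.+1 : hom (p n.+1) (p n)).
  have [r [g [[f [fe fE]] _]]] := extension_resolution e.
  have gc : cocycle g.
    apply: (mono0 (ext_mono e)); rewrite compmA fE -compmA.
    by rewrite (rd_rd r n.+1) compm0.
  have [p [h [s [he hE]]]] := (null_extension_class fe fE).2 (ev r g gc).
  by exists p, h, s; rewrite hE compmA.
have [p1 [f1 [s1 [f1e f1E]]]] := nullE e1.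
have [p2 [f2 [s2 [f2e f2E]]]] := nullE e2.
have [p [h1 [h2 [h1c h2c]]]] := lift_resolution (idm M) p1 p2.
have gc0 : cocycle (0 : hom (p n.+1) N) by apply: comp0m.
have [e [_ up]] := cocycle_extension gc0.
suff map (q : ires M) (e' : extension n M N) (f : forall k, hom (q k) (ext_ob e' k)) (s
  : hom (q n) N) (h : forall k, hom (p k) (q k)) :
    @to_extension _ _ _ _ (idm M) q e' f -> @chain_map _ _ _ (idm M) p q h ->
    ext_inj e' \oc (s \oc rd q n.+1) = f n \oc (rd q n.+1 : hom (q n.+1) (q n)) ->
    extension_morphism e e'.
  apply: Relation_Operators.rst_trans (Relation_Operators.rst_step _ _ _ _ (map _ _ _ _
    _ f2e h2c f2E)).
  apply: Relation_Operators.rst_sym; apply: Relation_Operators.rst_step.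
  exact: map f1e h1c f1E.
move=> fe hc fE; apply/extension_mapP.
apply: (up _ _ _ (fun k => f k \oc h k) (s \oc h n)).
  move=> k kn; rewrite compmA fe // -compmA hc compmA.
  by case: k {kn} => [|k]; rewrite ?comp1m.
have /= hn := hc n.+1; rewrite add0r -(compmA s) -(compmA (f n)) -hn.
by rewrite (compmA s) (compmA (ext_inj e')) fE -compmA.
Qed.

End YonedaExt.

(** * Gorenstein objects *)

Section Splitting.
Local Open Scope ring_scope.
Variable A : abelian_category.
Implicit Types B C D E K L M N P Q S T U V W Y Z : A.

Definition Ext1_split M N : Prop := forall E (i : hom N E) (p : hom E M),
  ses i p -> exists s : hom M E, p \oc s = idm M.

Lemma section_retraction N E M (i : hom N E) (p : hom E M) (s : hom M E) :
  ses i p -> p \oc s = idm M -> exists r : hom E N, r \oc i = idm N /\ ses s r.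
Proof.
move=> ip ps; have [|r rE] := ses_lift (z := idm E - s \oc p) ip.
  by rewrite compmBr compm1 compmA ps comp1m subrr.
have ri : r \oc i = idm N.
  apply: (ses_mono ip); rewrite compmA rE compmBl comp1m compm1 -compmA (ses0 ip).
  by rewrite compm0 subr0.
exists r; split=> //; split; last first.
  by apply: (@epi_of_comp _ _ _ _ r i); rewrite ri; apply: epi_id.
apply/is_kernelP; split.
- apply: (ses_mono ip); rewrite compmA rE compmBl comp1m -compmA ps compm1 subrr.
  by rewrite compm0.
- by apply: (@mono_of_comp _ _ _ _ p); rewrite ps; apply: mono_id.
- move=> Z z rz; exists (p \oc z); apply/eqP.
  rewrite compmA eq_sym -subr_eq0 -[X in X - _]comp1m -compmBl -rE -compmA rz.
  by rewrite compm0.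
Qed.

Lemma retraction_section N E M (i : hom N E) (p : hom E M) (r : hom E N) :
  ses i p -> r \oc i = idm N -> exists s : hom M E, p \oc s = idm M.
Proof.
move=> ip ri; have [|s sE] := ses_desc (z := idm E - i \oc r) ip.
  by rewrite compmBl comp1m -compmA ri compm1 subrr.
exists s; apply: (ses_epi ip); rewrite -compmA sE compmBr compm1 compmA (ses0 ip).
by rewrite comp0m subr0 comp1m.
Qed.

Lemma Ext1_extend M N K C (k : hom K C) (e : hom C M) (v : hom K N) :
  Ext1_split M N -> ses k e -> exists w : hom C N, w \oc k = v.
Proof.
move=> spl ke; have [Q [a [b [d [bd _ akbv _]]]]] := ses_pushout v ke.
have [s ds] := spl _ _ _ bd; have [r [rb _]] := section_retraction bd ds.
by exists (r \oc a); rewrite -compmA akbv compmA rb comp1m.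
Qed.

Lemma Ext1_lift M N C D (k : hom N C) (e : hom C D) (v : hom M D) :
  Ext1_split M N -> ses k e -> exists w : hom M C, e \oc w = v.
Proof.
move=> spl ke; have [Q [a [b [d [db _ eavb _]]]]] := ses_pullback v ke.
have [s bs] := spl _ _ _ db.
by exists (a \oc s); rewrite compmA eavb -compmA bs compm1.
Qed.

Lemma Ext1_split_retractl M M' N (i : hom M' M) (r : hom M M') :
  r \oc i = idm M' -> Ext1_split M N -> Ext1_split M' N.
Proof.
move=> ri spl E j p jp; have [w wE] := Ext1_lift r spl jp.
by exists (w \oc i); rewrite compmA wE.
Qed.

Lemma Ext1_split_retractr M N N' (i : hom N' N) (r : hom N N') :
  r \oc i = idm N' -> Ext1_split M N -> Ext1_split M N'.
Proof.
move=> ri spl E j p jp; have [w wE] := Ext1_extend i spl jp.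
by apply: (retraction_section (r := r \oc w) jp); rewrite -compmA wE.
Qed.

(** A short exact sequence has the class of [rd t 0] on its splice with the trivial resolution of
    [N]; when [s] bounds it, [f 0 - i \oc s] descends to a section. Conversely, a cocycle of degree
    1 is a map [K -> N], and splitting extends it to [p 0], which makes it a coboundary on [p]
    itself. *)
Lemma Ext_vanish1P M N : Ext_vanish 1 M N <-> Ext1_split M N.
Proof.
split=> [ev E i p ip|spl p g gc].
  have [t _] := trivial_resolution N.
  have gc : cocycle (p := cons_ires ip t) (n := 1) (rd t 0) := rd_rd t 0.
  have [q [f [s [fc fE]]]] := ev _ _ gc.
  have f1 : i \oc rd t 0 \oc f 1%N = f 0%N \oc rd q 1 := fc 1%N.
  have f0 : p \oc f 0%N = idm M \oc rd q 0 := fc 0%N.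
  have [|w wE] := exact_desc (x := f 0%N - i \oc s) (rd_exact q 0) (@rd_epi _ _ q).
    by rewrite compmBl -f1 -!compmA -fE subrr.
  exists w; apply: (@rd_epi _ _ q).
  by rewrite -compmA wE compmBr f0 compmA (ses0 ip) comp0m subr0.
have [K [k [l [kp kl]]]] := tail_exists p.
have [v vE] := exact_desc (rd_exact (tail_ires kp kl) 0) (rd_epi (tail_ires kp kl)) gc.
have [w wE] := Ext1_extend v spl kp.
exists p, (fun k => idm _), w; split; first exact: chain_id.
by rewrite compm1 -vE -wE -kl compmA.
Qed.

End Splitting.

Section ProperSequences.
Local Open Scope ring_scope.
Variable A : abelian_category.
Variable X : A -> Prop.
Implicit Types B C D E I J K L M N P Q S T U V W Y Z : A.

(** Exactness under Hom(T, -) and Hom(-, T) amounts to these two surjectivities, the rest being left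
    exactness. *)
Definition proper_ses B C D (f : hom B C) (g : hom C D) : Prop :=
  ses f g /\ forall T, X T ->
    (forall t : hom T D, exists w, g \oc w = t) /\
    (forall t : hom B T, exists w, w \oc f = t).

(* Horseshoe: the extension [w] of [f] to B replaces injectivity of U. *)
Lemma horseshoe B1 B B2 (i : hom B1 B) (p : hom B B2) U C1 (f : hom B1 U) (g : hom U C1)
    V C2 (f' : hom B2 V) (g' : hom V C2) (w : hom B U) :
  ses i p -> proper_ses f g -> proper_ses f' g' -> w \oc i = f ->
  exists S C (phi : hom B S) (q : hom S C) (al : hom C1 C) (be : hom C C2),
    [/\ biproduct U V S, proper_ses phi q & ses al be].
Proof.
move=> ip [fg fgX] [fg' fgX'] wi.
pose phi := pair w (f' \oc p).
have phi_i : phi \oc i = inj1 \oc f.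
  by rewrite pair_comp wi -compmA (ses0 ip) compm0 /pair compm0 addr0.
have prj1phi : prj1 \oc phi = w by apply: prj1_pair.
have prj2phi : prj2 \oc phi = f' \oc p by apply: prj2_pair.
have phim : mono phi.
  apply/monoP => Z z phiz.
  have wz : w \oc z = 0 by rewrite -prj1phi -compmA phiz compm0.
  have pz : p \oc z = 0.
    by apply: (mono0 (ses_mono fg')); rewrite compmA -prj2phi -compmA phiz compm0.
  have [h hE] := ses_lift ip pz; rewrite -hE.
  rewrite -hE compmA wi in wz; rewrite (mono0 (ses_mono fg) wz).
  exact: compm0.
have [C [q phic]] := has_cokernels phi.
have phiq := coker_ses phim phic.
have [|al alE] := ses_desc (z := q \oc inj1) fg.
  by rewrite -compmA -phi_i compmA (ses0 phiq) comp0m.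
have [|be beE] := ses_desc (z := g' \oc prj2) phiq.
  by rewrite -compmA prj2phi compmA (ses0 fg') comp0m.
have split_prj2 Z (z : hom Z (bp U V)) : prj2 \oc z = 0 -> z = inj1 \oc (prj1 \oc z).
  by move=> z2; rewrite -{1}(pair_eta z) z2 /pair compm0 addr0.
have be0 : be \oc al = 0.
  apply: (ses_epi fg); rewrite -compmA alE compmA beE -compmA prj2_inj1.
  by rewrite compm0 comp0m.
have albe : ses al be.
  apply: sesP.
  - apply/monoP => Z z alz.
    have [T1 [t1 [y [t1e yE]]]] := epi_local z (ses_epi fg).
    have [|b bE] := ses_lift (z := inj1 \oc y) phiq.
      by rewrite compmA -alE -compmA yE compmA alz comp0m.
    have [|a aE] := ses_lift (z := b) ip.
      apply: (mono0 (ses_mono fg')).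
      by rewrite compmA -prj2phi -compmA bE compmA prj2_inj1 comp0m.
    apply: (epi0 t1e); rewrite -yE.
    have -> : y = f \oc a.
      rewrite -wi -compmA aE -prj1phi -compmA bE compmA prj1_inj1.
      by rewrite comp1m.
    by rewrite compmA (ses0 fg) comp0m.
  - apply: (@epi_of_comp _ _ _ _ _ q); rewrite beE.
    apply: epi_comp (ses_epi fg') _; apply: (@epi_of_comp _ _ _ _ _ inj2).
    by rewrite prj2_inj2; apply: epi_id.
  - split=> // T z bez; have [T1 [t1 [x [t1e xE]]]] := epi_local z (ses_epi phiq).
    have [|c cE] := ses_lift (z := prj2 \oc x) fg'.
      by rewrite compmA -beE -compmA xE compmA bez comp0m.
    have [T2 [t2 [b [t2e bE]]]] := epi_local c (ses_epi ip).
    have x2 : prj2 \oc (x \oc t2 - phi \oc b) = 0.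
      by rewrite compmBr !compmA -cE prj2phi -!compmA bE subrr.
    exists T2, (t1 \oc t2), (g \oc (prj1 \oc (x \oc t2 - phi \oc b))).
    split; first exact: epi_comp.
    rewrite compmA alE -compmA -split_prj2 // compmBr !compmA (ses0 phiq) comp0m.
    by rewrite subr0 xE.
exists (bp U V), C, phi, q, al, be; split=> //; first exact: bp_biproduct.
split=> // T XT; split=> t.
  have [v vE] := (fgX' _ XT).1 (be \oc t).
  have [|a aE] := ses_lift (z := t - q \oc (inj2 \oc v)) albe.
    by rewrite compmBr !compmA beE -(compmA g') prj2_inj2 compm1 vE subrr.
  have [u uE] := (fgX _ XT).1 a; exists (pair u v).
  rewrite /pair compmDr [q \oc (inj1 \oc u)]compmA -alE -compmA uE aE.
  by rewrite addrNK.
have [w1 w1E] := (fgX _ XT).2 (t \oc i).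
have [|h hE] := ses_desc (z := t - w1 \oc w) ip.
  by rewrite compmBl -compmA wi w1E subrr.
have [h' h'E] := (fgX' _ XT).2 h; exists (copair w1 h').
by rewrite copair_pair compmA h'E hE addrC addrNK.
Qed.

End ProperSequences.

Section GorensteinObjects.
Local Open Scope ring_scope.
Variable A : abelian_category.
Variable X : A -> Prop.
Implicit Types B C D E I J K L M N P Q S T U V W Y Z : A.

Lemma op_proper_ses B C D (f : hom B C) (g : hom C D) :
  @proper_ses (op A) X D C B g f <-> proper_ses X f g.
Proof.
by split=> -[/op_ses s h]; split=> // T /h [h1 h2]; split.
Qed.

Lemma X_exact_splice B I C J D (e : hom B I) (m : hom I C) (e' : hom C J) (m' : hom J
  D) :
  proper_ses X m e' ->
  epi e -> (forall T, X T -> forall t : hom T I, exists w, e \oc w = t) ->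
  mono m' -> (forall T, X T -> forall t : hom J T, exists w, w \oc m' = t) ->
  X_exact_at X (m \oc e) (m' \oc e').
Proof.
move=> [s sX] ee eX mm mX; split.
  apply/exact_atP/(exact_monol _ _ mm); apply: kernel_exact => //.
  by case: s.
move=> T XT; split=> v; split.
- rewrite -compmA => /(mono0 mm) /(ses_lift s) [h hE].
  by have [w wE] := eX _ XT h; exists w; rewrite -compmA wE.
- by move=> [u <-]; rewrite -!compmA (compmA e') (ses0 s) comp0m compm0.
- rewrite compmA => /(epi0 ee) /(ses_desc s) [h hE].
  by have [w wE] := mX _ XT h; exists w; rewrite compmA wE.
- by move=> [u <-]; rewrite !compmA -(compmA _ e') (ses0 s) compm0 comp0m.
Qed.

(** Exactness at [D] lifts maps [T -> J] to [C], exactness at [B] extends maps [I -> T] to [C], and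
    exactness at [C] gives the sequence itself. *)
Lemma X_exact_images B' B I C J D D' (f0 : hom B' B) (e : hom B I) (m : hom I C)
    (e' : hom C J) (m' : hom J D) (h : hom D D') :
  epi e -> mono m -> epi e' -> mono m' ->
  X_exact_at X f0 (m \oc e) -> X_exact_at X (m \oc e) (m' \oc e') ->
  X_exact_at X (m' \oc e') h -> proper_ses X m e'.
Proof.
move=> ee mm ee' mm' [/exact_atP x0 x0X] [/exact_atP x1 _] [/exact_atP x2 x2X].
have x1' := (exact_monol (m \oc e) e' mm').2 x1.
split.
  apply: sesP => //; split.
    by apply: ee; rewrite -compmA x1'.1 comp0m.
  move=> T z /x1'.2 [T' [t [y [te yE]]]]; exists T', t, (e \oc y).
  by split=> //; rewrite compmA.
move=> T XT; split=> t.
  have [|u uE] := ((x2X _ XT).1 (m' \oc t)).1.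
    rewrite compmA; have -> : h \oc m' = 0 by apply: ee'; rewrite -compmA x2.1 comp0m.
    by rewrite comp0m.
  by exists u; apply: mm'; rewrite compmA.
have [|u uE] := ((x0X _ XT).2 (t \oc e)).1.
  rewrite -compmA; have -> : e \oc f0 = 0 by apply: mm; rewrite compmA x0.1 compm0.
  by rewrite compm0.
by exists u; apply: ee; rewrite -compmA.
Qed.

Lemma image_comp B I C (e : hom B I) (m : hom I C) : epi e -> mono m -> is_image (m \oc
  e) m.
Proof.
move=> ee mm; have [D [c mc]] := has_cokernels m; exists D, c; split; last first.
  exact: mono_kernel_cokernel.
have [cm ce cd] := (is_cokernelP _ _).1 mc; apply/is_cokernelP; split=> //.
  by rewrite compmA cm comp0m.
by move=> Z g; rewrite compmA => /(epi0 ee); apply: cd.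
Qed.

Lemma isomorphic_refl M : isomorphic M M.
Proof. by exists (idm M), (idm M); rewrite comp1m. Qed.

Lemma Gorenstein_iso M N : isomorphic M N -> Gorenstein X M -> Gorenstein X N.
Proof.
move=> [f [g [gf fg]]] [L [R [dL [dR [h1 h2 h3 h4 [I [m [im [a [b [ba ab]]]]]]]]]]].
exists L, R, dL, dR; split=> //; exists I, m; split=> //.
exists (a \oc g), (f \oc b); split.
  by rewrite -compmA (compmA b) ba comp1m.
by rewrite -compmA (compmA g) gf comp1m.
Qed.

Lemma proper_ses_isol B B' C D (f : hom B C) (g : hom C D) (a : hom B' B) :
  is_iso a -> proper_ses X f g -> proper_ses X (f \oc a) g.
Proof.
move=> [b [ba ab]] [s sX]; split.
  split; last exact: ses_epi s.
  apply/is_kernelP; split.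
  - by rewrite compmA (ses0 s) comp0m.
  - apply: mono_comp (ses_mono s) _.
    by apply: (@mono_of_comp _ _ _ _ b); rewrite ba; apply: mono_id.
  - move=> Z z /(ses_lift s) [h hE]; exists (b \oc h).
    by rewrite -compmA (compmA a) ab comp1m.
move=> T XT; split=> t; first exact: (sX _ XT).1.
have [w wE] := (sX _ XT).2 (t \oc b); exists w.
by rewrite compmA wE -compmA ba compm1.
Qed.

Lemma proper_ses_isor B C D D' (f : hom B C) (g : hom C D) (a : hom D D') :
  is_iso a -> proper_ses X f g -> proper_ses X f (a \oc g).
Proof.
move=> [b [ba ab]] [s sX]; split.
  split; last first.
    apply: epi_comp _ (ses_epi s).
    by apply: (@epi_of_comp _ _ _ _ _ b); rewrite ab; apply: epi_id.
  apply/is_kernelP; split.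
  - by rewrite -compmA (ses0 s) compm0.
  - exact: ses_mono s.
  - move=> Z z e; apply: ses_lift s _.
    by have := congr1 (fun x => b \oc x) e; rewrite !compmA ba comp1m compm0.
move=> T XT; split=> t; last exact: (sX _ XT).2.
have [w wE] := (sX _ XT).1 (b \oc t); exists w.
by rewrite -compmA wE compmA ab comp1m.
Qed.

Lemma Gorenstein_cosyzygy M : Gorenstein X M ->
  exists V M' (f : hom M V) (g : hom V M'), [/\ X V, Gorenstein X M' & proper_ses X f
    g].
Proof.
move=> [L [R [dL [dR [XLR xL x0 xR [I [m [im [a ai]]]]]]]]].
have [mm [e [ee eE]]] := is_image_factor im.
have [J [m' im']] := image_exists (dR 0%N).
have [mm' [e' [ee' e'E]]] := is_image_factor im'.
have pe : proper_ses X m e'.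
  apply: (@X_exact_images _ _ _ _ _ _ _ (dL 1%N) e m e' m' (dR 1%N)) => //;
    rewrite ?eE ?e'E //.
exists (R 0%N), J, (m \oc a), e'; split; [exact: (XLR 0%N).2| |exact: proper_ses_isol].
exists (aug (R 0%N) L), (fun k => R k.+1), (fun k =>
  match k return hom (aug (R 0%N) L k) (aug (R 1%N) (aug (R 0%N) L) k) with
  | 0 => dR 0%N | j.+1 => dL j end), (fun k => dR k.+1); split.
- by move=> [|k]; split; [exact: (XLR 0%N).2|exact: (XLR 1%N).2|exact: (XLR k).1|exact:
  (XLR k.+2).2].
- by case=> [|k]; [exact: x0|exact: xL].
- exact: (xR 0%N).
- by move=> k; apply: (xR k.+1).
- by exists J, m'; split=> //; apply: isomorphic_refl.
Qed.

Lemma Gorenstein_syzygy M : Gorenstein X M ->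
  exists V M' (f : hom M' V) (g : hom V M), [/\ X V, Gorenstein X M' & proper_ses X f
    g].
Proof.
move=> [L [R [dL [dR [XLR xL x0 xR [I [m [im [a [b [ba ab]]]]]]]]]]].
have [mm [e [ee eE]]] := is_image_factor im.
have [J [m' im']] := image_exists (dL 1%N : hom (L 1%N) (L 0%N)).
have [mm' [e' [ee' e'E]]] := is_image_factor im'.
have pe : proper_ses X m' e.
  apply: (@X_exact_images _ _ _ _ _ _ _ (dL 2%N : hom (L 2%N) (L 1%N)) e' m' e m (dR
    0%N)) => //; rewrite ?eE ?e'E //.
exists (L 0%N), J, m', (b \oc e); split; [exact: (XLR 0%N).1| |].
  exists (fun k => L k.+1), (aug (L 0%N) R), (fun k =>
    match k return hom (L k.+1) (aug (L 0%N) (fun j => L j.+1) k) with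
    | 0 => dL 1%N | j.+1 => dL j.+2 end), (fun k =>
    match k return hom (aug (L 0%N) R k) (aug (L 0%N) R k.+1) with
    | 0 => dL 0%N | j.+1 => dR j end); split.
  - by move=> [|k]; split; [exact: (XLR 1%N).1|exact: (XLR 0%N).1|exact: (XLR
    k.+2).1|exact: (XLR k).2].
  - by case=> [|k]; [exact: (xL 1%N)|exact: (xL k.+2)].
  - exact: (xL 0%N).
  - by case=> [|k]; [exact: x0|exact: xR].
  - by exists J, m'; split=> //; apply: isomorphic_refl.
by apply: proper_ses_isor pe; exists a.
Qed.

Record cosyzygy (H : A -> Prop) M := Cosyzygy {
  cosyz_mid : A; cosyz_ob : A;
  cosyz_in : hom M cosyz_mid; cosyz_out : hom cosyz_mid cosyz_ob;
  cosyz_X : X cosyz_mid; cosyz_H : H cosyz_ob;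
  cosyz_proper : proper_ses X cosyz_in cosyz_out }.

Record syzygy (H : A -> Prop) M := Syzygy {
  syz_mid : A; syz_ob : A;
  syz_in : hom syz_ob syz_mid; syz_out : hom syz_mid M;
  syz_X : X syz_mid; syz_H : H syz_ob;
  syz_proper : proper_ses X syz_in syz_out }.

Section Coinduction.
Variable H : A -> Prop.
Hypothesis Hco : forall M, H M -> exists V M' (f : hom M V) (g : hom V M'),
  [/\ X V, H M' & proper_ses X f g].
Hypothesis Hsy : forall M, H M -> exists V M' (f : hom M' V) (g : hom V M),
  [/\ X V, H M' & proper_ses X f g].

Lemma cosyzygy_exists (s : {M | H M}) : exists _ : cosyzygy H (sval s), True.
Proof.
have [V [M' [f [g [XV HM' pe]]]]] := Hco (svalP s).
by exists (Cosyzygy XV HM' pe).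
Qed.

Lemma syzygy_exists (s : {M | H M}) : exists _ : syzygy H (sval s), True.
Proof.
have [V [M' [f [g [XV HM' pe]]]]] := Hsy (svalP s).
by exists (Syzygy XV HM' pe).
Qed.

Let co s := sval (cid (cosyzygy_exists s)).
Let sy s := sval (cid (syzygy_exists s)).
Let conext s : {M | H M} := exist H _ (cosyz_H (co s)).
Let synext s : {M | H M} := exist H _ (syz_H (sy s)).

(** Chosen syzygies and cosyzygies iterate in both directions and splice to a complete sequence. As
    a coinduction principle, this reduces closure properties to exhibiting an invariant class
    [H]. *)
Lemma Gorenstein_coind M : H M -> Gorenstein X M.
Proof.
move=> HM; pose s0 : {M | H M} := exist H M HM.
pose rs k := iter k conext s0.
pose ls k := iter k synext s0.
pose R k := cosyz_mid (co (rs k)).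
pose L k := syz_mid (sy (ls k)).
pose dR k : hom (R k) (R k.+1) := cosyz_in (co (rs k.+1)) \oc cosyz_out (co (rs k)).
pose dL k : hom (L k) (aug (R 0%N) L k) :=
  match k return hom (L k) (aug (R 0%N) L k) with
  | 0 => cosyz_in (co s0) \oc syz_out (sy s0)
  | j.+1 => syz_in (sy (ls j)) \oc syz_out (sy (ls j.+1)) end.
have pco s := cosyz_proper (co s).
have psy s := syz_proper (sy s).
have pco_ext s T (XT : X T) := ((pco s).2 T XT).2.
have pco_lift s T (XT : X T) := ((pco s).2 T XT).1.
have psy_ext s T (XT : X T) := ((psy s).2 T XT).2.
have psy_lift s T (XT : X T) := ((psy s).2 T XT).1.
exists L, R, dL, dR; split.
- by move=> k; split; [exact: (syz_X (sy (ls k)))|exact: (cosyz_X (co (rs k)))].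
- case=> [|k].
    exact (X_exact_splice (psy s0) (ses_epi (psy (ls 1%N)).1) (psy_lift (ls 1%N))
      (ses_mono (pco s0).1) (pco_ext s0)).
  exact (X_exact_splice (psy (ls k.+1)) (ses_epi (psy (ls k.+2)).1) (psy_lift (ls k.+2))
    (ses_mono (psy (ls k)).1) (psy_ext (ls k))).
- exact (X_exact_splice (pco s0) (ses_epi (psy s0).1) (psy_lift s0)
    (ses_mono (pco (rs 1%N)).1) (pco_ext (rs 1%N))).
- move=> k; exact (X_exact_splice (pco (rs k.+1)) (ses_epi (pco (rs k)).1)
    (pco_lift (rs k)) (ses_mono (pco (rs k.+2)).1) (pco_ext (rs k.+2))).
- exists M, (cosyz_in (co s0)); split; last exact: isomorphic_refl.
  exact: image_comp (ses_epi (psy s0).1) (ses_mono (pco s0).1).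
Qed.

End Coinduction.

Hypothesis Xadd : additive_subcategory X.
Hypothesis Xorth : forall T T', X T -> X T' -> Ext1_split T T'.

(** With 0 -> M' -> V -> M -> 0 proper, Ext^1(M, T) is the cokernel of Hom(V, T) -> Hom(M', T), as
    Ext^1(V, T) = 0; properness makes that map surjective. *)
Lemma Gorenstein_split M T : Gorenstein X M -> X T -> Ext1_split M T.
Proof.
move=> /Gorenstein_syzygy [V [M' [f [g [XV GM' [fg fgX]]]]]] XT E i p ip.
have [l lE] := Ext1_lift g (Xorth XV XT) ip.
have [|n nE] := ses_lift (z := l \oc f) ip; first by rewrite compmA lE (ses0 fg).
have [w wE] := (fgX _ XT).2 n.
have [|s sE] := ses_desc (z := l - i \oc w) fg.
  by rewrite compmBl -compmA wE nE subrr.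
exists s; apply: (ses_epi fg); rewrite -compmA sE compmBr lE compmA (ses0 ip).
by rewrite comp0m subr0 comp1m.
Qed.

Lemma split_Gorenstein T M : X T -> Gorenstein X M -> Ext1_split T M.
Proof.
move=> XT /Gorenstein_cosyzygy [V [M' [f [g [XV GM' [fg fgX]]]]]] E i p ip.
have [w wE] := Ext1_extend f (Xorth XT XV) ip.
have [|h hE] := ses_desc (z := g \oc w) ip; first by rewrite -compmA wE (ses0 fg).
have [h' h'E] := (fgX _ XT).1 h.
have [|r rE] := ses_lift (z := w - h' \oc p) fg.
  by rewrite compmBr compmA h'E hE subrr.
apply: (retraction_section (r := r) ip); apply: (ses_mono fg).
by rewrite compmA rE compmBl -compmA wE (ses0 ip) compm0 subr0 compm1.
Qed.

(** The invariant class consists of all extensions of Gorenstein objects. The envelope of [B1]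
    extends to [B] because Ext^1(B2, U) = 0, and the horseshoe gives a cosyzygy that is again such
    an extension; syzygies are treated in the opposite category. *)
Lemma Gorenstein_extension B1 B B2 (i : hom B1 B) (p : hom B B2) :
  ses i p -> Gorenstein X B1 -> Gorenstein X B2 -> Gorenstein X B.
Proof.
have [_ _ Xbi] := Xadd.
pose H B := exists B1 B2 (i : hom B1 B) (p : hom B B2),
  [/\ ses i p, Gorenstein X B1 & Gorenstein X B2].
move=> ip G1 G2; apply: (@Gorenstein_coind H); last by exists B1, B2, i, p.
  move=> {i p ip G1 G2 B1 B2 B} B [B1 [B2 [i [p [ip G1 G2]]]]].
  have [U [C1 [f [g [XU GC1 fg]]]]] := Gorenstein_cosyzygy G1.
  have [V [C2 [f' [g' [XV GC2 fg']]]]] := Gorenstein_cosyzygy G2.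
  have [w wE] := Ext1_extend f (Gorenstein_split G2 XU) ip.
  have [S [C [phi [q [al [be [bi pq ab]]]]]]] := horseshoe ip fg fg' wE.
  exists S, C, phi, q; split=> //; first exact: (Xbi _ _ _ XU XV bi).
  by exists C1, C2, al, be.
move=> {i p ip G1 G2 B1 B2 B} B [B1 [B2 [i [p [ip G1 G2]]]]].
have [U [C1 [f [g [XU GC1 fg]]]]] := Gorenstein_syzygy G1.
have [V [C2 [f' [g' [XV GC2 fg']]]]] := Gorenstein_syzygy G2.
have [w wE] := Ext1_lift g' (split_Gorenstein XV G1) ip.
move/op_ses: ip => ip; move/op_proper_ses: fg => fg; move/op_proper_ses: fg' => fg'.
have [S [C [phi [q [al [be [bi pq ab]]]]]]] :=
  @horseshoe (op A) X _ _ _ _ _ _ _ _ _ _ _ _ _ _ ip fg' fg wE.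
exists S, C, q, phi; split; last by apply/op_proper_ses.
  apply: (Xbi V U) => //; case: bi => j1 [j2 [q1 [q2 [e1 e2 e3 e4 e5]]]].
  by exists q1, q2, j1, j2.
by exists C1, C2, be, al; split=> //; apply/op_ses.
Qed.

Lemma zero_mono Z B : zero_object Z -> mono (0 : hom Z B).
Proof. by move=> [Z0 _] Y u v _; rewrite (Z0 _ u) (Z0 _ v). Qed.

Lemma ses_id_zero Z B : zero_object Z -> ses (idm B) (0 : hom B Z).
Proof.
move=> Z0; split; last exact: epi_to_zero.
apply/is_kernelP; split; [exact: comp0m|exact: mono_id|].
by move=> Y g _; exists g; rewrite comp1m.
Qed.

Lemma ses_zero_id Z B : zero_object Z -> ses (0 : hom Z B) (idm B).
Proof.
move=> Z0; split; last exact: epi_id.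
apply/is_kernelP; split; [exact: compm0|exact: zero_mono|].
by move=> Y g; rewrite comp1m => ->; exists 0; rewrite compm0.
Qed.

Lemma X_Gorenstein T : X T -> Gorenstein X T.
Proof.
have [_ X0 _] := Xadd; have [Z Z0] := has_zero A; have XZ := X0 _ Z0.
apply: Gorenstein_coind => {}T XT.
  exists T, Z, (idm T), 0; split=> //; split; first exact: ses_id_zero.
  move=> S XS; split=> t; first by exists 0; rewrite (Z0.1 _ t) compm0.
  by exists t; rewrite compm1.
exists T, Z, 0, (idm T); split=> //; split; first exact: ses_zero_id.
move=> S XS; split=> t; first by exists t; rewrite comp1m.
by exists 0; rewrite (Z0.2 _ t) compm0.
Qed.

(** The invariant class is G with [K] adjoined, so only [K] needs a step each way. The composite of
    [s] with an envelope of [Q] has as cokernel an extension of [Q'] by [U]; the composite of a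
    cover of [Q] with [p] has as kernel an extension of [U] by the syzygy of [Q]. Both lie in G, and
    vanishing of Ext^1 against [X] makes the sequences proper. *)
Lemma Gorenstein_summand U Q K (i : hom U Q) (p : hom Q K) (s : hom K Q) :
  ses i p -> p \oc s = idm K -> X U -> Gorenstein X Q -> Gorenstein X K.
Proof.
move=> ip ps XU GQ; have [r [ri sr]] := section_retraction ip ps.
have KT T : X T -> Ext1_split K T.
  by move=> XT; apply: Ext1_split_retractl ps _; apply: Gorenstein_split.
have TK T : X T -> Ext1_split T K.
  by move=> XT; apply: Ext1_split_retractr ps _; apply: split_Gorenstein.
have GU := X_Gorenstein XU.
apply: (@Gorenstein_coind (fun M => Gorenstein X M \/ M = K)); last by right.
  move=> M [|->].
    move=> /Gorenstein_cosyzygy [V [M' [f [g [XV GM' fg]]]]].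
    by exists V, M', f, g; split=> //; left.
  have [V [Q' [f [g [XV GQ' [fg fgX]]]]]] := Gorenstein_cosyzygy GQ.
  have [W [q [j [d [kq jd]]]]] := ses_comp_mono sr fg.
  have GW := Gorenstein_extension jd GU GQ'.
  exists V, W, (f \oc s), q; split=> //; first by left.
  split=> // T XT; split=> t; first exact: Ext1_lift (TK _ XT) kq.
  exact: Ext1_extend (Gorenstein_split GW XT) kq.
move=> M [|->].
  move=> /Gorenstein_syzygy [V [M' [f [g [XV GM' fg]]]]].
  by exists V, M', f, g; split=> //; left.
have [V [Q' [f [g [XV GQ' [fg fgX]]]]]] := Gorenstein_syzygy GQ.
have [P [j [q [l [jq lq]]]]] := ses_comp_epi ip fg.
have GP := Gorenstein_extension lq GQ' GU.
exists V, P, j, (p \oc g); split=> //; first by left.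
split=> // T XT; split=> t; first exact: Ext1_lift (split_Gorenstein XT GP) jq.
exact: Ext1_extend (KT _ XT) jq.
Qed.

End GorensteinObjects.

(** * Resolutions of finite length *)

Section FiniteResolutions.
Local Open Scope ring_scope.
Variable A : abelian_category.
Implicit Types B C D E I J K L M N P Q S T U V W Y Z : A.

Lemma mono_epi_iso B C (f : hom B C) : mono f -> epi f -> is_iso f.
Proof.
move=> fm fe; have [D [h /is_cokernelP[fh _ hl]]] := epi_is_cokernel fe.
have [|s sf] := hl _ (idm B); first by rewrite (mono0 fm fh) compm0.
by exists s; split=> //; apply: fe; rewrite -compmA sf comp1m compm1.
Qed.

Lemma iso_mono B C (f : hom B C) : is_iso f -> mono f.
Proof. by move=> [g [gf _]]; apply: (@mono_of_comp _ _ _ _ g); rewrite gf;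
  apply: mono_id. Qed.

Lemma iso_epi B C (f : hom B C) : is_iso f -> epi f.
Proof. by move=> [g [_ fg]]; apply: (@epi_of_comp _ _ _ _ _ g); rewrite fg;
  apply: epi_id. Qed.

Lemma has_resolution0 (P : nat -> A -> Prop) M :
  has_resolution P 0 M <-> exists C, isomorphic C M /\ P 0%N C.
Proof.
split=> [[D [d [d0 _ dm PD]]]|[C [[f fi] PC]]].
  exists (D 0%N); split; last exact: PD.
  by exists (d 0%N); apply: mono_epi_iso.
exists (fun=> C), (fun k => match k return hom C (aug M (fun=> C) k) with
  | 0 => f | _.+1 => 0 end); split=> //; [exact: iso_epi|exact: iso_mono|].
by case.
Qed.

Lemma has_resolutionS (P : nat -> A -> Prop) n M :
  has_resolution P n.+1 M <-> exists K C (k : hom K C) (e : hom C M),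
    [/\ ses k e, P 0%N C & has_resolution (fun j => P j.+1) n K].
Proof.
split.
  move=> [D [d [d0 dx dm PD]]]; have [K [k kd]] := ses_kernel d0.
  have dx0 := (exact_atP _ _).1 (dx 0%N isT).
  have [l lE] := ses_lift kd dx0.1.
  exists K, (D 0%N), k, (d 0%N); split; [by []|exact: PD|].
  exists (fun j => D j.+1), (tail_d d l); split.
  - apply: local_epi => T z; have [|T' [t [y [te yE]]]] := dx0.2 _ (k \oc z).
      by rewrite compmA (ses0 kd) comp0m.
    by exists T', t, y; split=> //; apply: (ses_mono kd); rewrite !compmA lE yE.
  - move=> [|j] jn; last exact: (dx j.+2).
    apply/exact_atP/(exact_monol _ _ (ses_mono kd)); rewrite lE.
    by apply/exact_atP; apply: (dx 1%N).
  - case: n dm {dx PD} => [|n] dm //.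
    by apply: (@mono_of_comp _ _ _ _ k); rewrite lE.
  - by move=> j jn; apply: PD.
move=> [K [C [k [e [ke PC [D [d [d0 dx dm PD]]]]]]]].
exists (aug C D), (cons_d e k d); split; first exact: ses_epi ke.
- move=> [|[|j]] jn /=; last exact: (dx j.+1).
    by apply/exact_atP; apply: kernel_exact => //; case: ke.
  apply/exact_atP/(exact_monol _ _ (ses_mono ke)).
  by apply/exact_atP; apply: (dx 0%N).
- case: n dm {dx PD} => [|n] dm //=.
  exact: mono_comp (ses_mono ke) dm.
- by case=> [|j] jn //=; apply: PD.
Qed.

Lemma has_resolution_mono (P P' : nat -> A -> Prop) n M :
  (forall k C, (k <= n)%N -> P k C -> P' k C) ->
  has_resolution P n M -> has_resolution P' n M.
Proof.
move=> PP' [D [d [d0 dx dm PD]]]; exists D, d; split=> // k kn.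
by apply: PP' => //; apply: PD.
Qed.

(** [dim] is the least length, so the content is that a resolution can be lengthened: a zero term is
    added at the far end. *)
Lemma dim_leP (X : A -> Prop) M n : (forall Z : A, zero_object Z -> X Z) ->
  (forall B C, isomorphic B C -> X B -> X C) ->
  dim_le X M n <-> has_resolution (fun=> X) n M.
Proof.
move=> X0 Xiso; have step m N : has_resolution (fun=> X) m N -> has_resolution (fun=>
  X) m.+1 N.
  elim: m N => [|m IHm] N.
    move=> /has_resolution0 [C [CN XC]]; apply/has_resolutionS.
    have [Z Z0] := has_zero A; exists Z, N, 0, (idm N); split.
    - exact: ses_zero_id.
    - exact: Xiso XC.
    - apply/has_resolution0; exists Z; split; first exact: isomorphic_refl.
      exact: X0.
  move=> /has_resolutionS [K [C [k [e [ke XC XK]]]]]; apply/has_resolutionS.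
  by exists K, C, k, e; split=> //; apply: IHm.
rewrite /dim_le /dim; case: pselect => [h|h]; last first.
  by split=> // hM; case: h; exists n; apply/asboolP.
case: ex_minnP => m /asboolP hm mmin; split=> [mn|hn].
  rewrite -(subnK mn); elim: (n - m)%N => [|i IHi] //.
  by rewrite addSn; apply: step.
by apply: mmin; apply/asboolP.
Qed.

Lemma dim_finiteP (X : A -> Prop) M :
  dim_finite X M <-> exists n, has_resolution (fun=> X) n M.
Proof.
rewrite /dim_finite /dim; case: pselect => [[n hn]|h]; split=> //.
  by move=> _; exists n; apply/asboolP.
by move=> [n hn]; case: h; exists n; apply/asboolP.
Qed.

End FiniteResolutions.

(** * Moving the Gorenstein term and bounding the dimension *)

Section GorensteinDimension.
Local Open Scope ring_scope.
Variable A : abelian_category.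
Variable X : A -> Prop.
Hypothesis Xadd : additive_subcategory X.
Hypothesis Xself : self_orthogonal X.
Implicit Types B C D E I J K L M N P Q S T U V W Y Z : A.
Local Notation G := (Gorenstein X).

Let Xorth T T' : X T -> X T' -> Ext1_split T T'.
Proof. by move=> XT XT'; apply/Ext_vanish1P/Ext_eq0P; apply: Xself. Qed.

Let XG T : X T -> G T := X_Gorenstein Xadd (T := T).

Lemma X_Ext_vanish T T' n : X T -> X T' -> Ext_vanish n.+1 T T'.
Proof. by move=> XT XT'; apply/Ext_eq0P; apply: Xself. Qed.

Lemma Gorenstein_Ext_vanish n M T : G M -> X T -> Ext_vanish n.+1 M T.
Proof.
elim: n M => [|n IHn] M GM XT.
  by apply/Ext_vanish1P; exact: (Gorenstein_split Xorth).
have [V [M' [f [g [XV GM' [fg _]]]]]] := Gorenstein_syzygy GM.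
exact: Ext_vanish_cokernel fg (IHn _ GM' XT) (X_Ext_vanish XV XT).
Qed.

Lemma has_resolution_G0 (P : nat -> A -> Prop) M : P 0%N = G ->
  has_resolution P 0 M <-> G M.
Proof.
move=> PG; split=> [/has_resolution0|GM].
  by rewrite PG => -[C [CM GC]]; apply: Gorenstein_iso GC.
by apply/has_resolution0; exists M; split; [exact: isomorphic_refl|rewrite PG].
Qed.

(** Pulling the first step of the resolution back along [d] keeps the tail; the new first term is an
    extension of the old one by [L]. *)
Lemma resolution_extension (P : nat -> A -> Prop) n L K' K (l : hom L K') (d : hom K'
  K) :
  (forall C, P 0%N C -> G C) -> ses l d -> G L -> has_resolution P n K ->
  has_resolution (fun k => if k == 0%N then G else P k) n K'.
Proof.
move=> PG ld GL; case: n => [|n].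
  move=> /has_resolution0 [C [CK PC]]; apply/has_resolution_G0 => //.
  by apply: (Gorenstein_extension Xadd Xorth) ld GL _ => //;
    apply: Gorenstein_iso CK (PG _ PC).
move=> /has_resolutionS [K1 [C [k [e [ke PC rK1]]]]].
have [P' [a [b [k' [l' [kb la]]]]]] := ses_pullback2 ke ld.
apply/has_resolutionS; exists K1, P', k', b; split=> //=.
by apply: (Gorenstein_extension Xadd Xorth) la GL _ => //; apply: PG.
Qed.

(** Cover the first term by an object of [X]; the new syzygy is an extension of the old one by an
    object of G, which the next term absorbs. Thus G moves one place away from [M]. *)
Lemma resolution_step (P : nat -> A -> Prop) n M :
  (forall C, P 0%N C -> G C) -> (forall C, P 1%N C -> G C) ->
  has_resolution P n.+1 M ->
  exists K V (k : hom K V) (e : hom V M), [/\ ses k e, X V &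
    has_resolution (fun k => if k == 0%N then G else P k.+1) n K].
Proof.
move=> PG0 PG1 /has_resolutionS [K [C [k [e [ke PC rK]]]]].
have [V [C' [f [g [XV GC' [fg _]]]]]] := Gorenstein_syzygy (PG0 _ PC).
have [P' [i [q [l [iq lq]]]]] := ses_comp_epi ke fg.
exists P', V, i, (e \oc g); split=> //.
exact: (@resolution_extension (fun j => P j.+1) _ _ _ _ _ _ PG1 lq GC' rK).
Qed.

Lemma G_resolution_step n M : has_resolution (fun=> G) n.+1 M ->
  exists K V (k : hom K V) (e : hom V M),
    [/\ ses k e, X V & has_resolution (fun=> G) n K].
Proof.
move=> /resolution_step [//|//|K [V [k [e [ke XV rK]]]]].
exists K, V, k, e; split=> //; apply: has_resolution_mono rK => j C _.
by case: eqP.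
Qed.

Lemma resolution_end n M : has_resolution (fun=> G) n M ->
  has_resolution (fun k => if k == n then G else X) n M.
Proof.
elim: n M => [|n IHn] M; first by move=> /has_resolution_G0 => /(_ erefl) GM;
  apply/has_resolution_G0.
move=> /G_resolution_step [K [V [k [e [ke XV /IHn rK]]]]].
by apply/has_resolutionS; exists K, V, k, e.
Qed.

(** The hull of Auslander-Buchweitz approximation: an envelope of the G-term [C], composed with
    [L -> C], has a cokernel [W] of finite X-dimension, into which [K = C / L] embeds. *)
Lemma cosyzygy_resolution n K : has_resolution (fun k => if k == 0%N then G else X) n K
  ->
  exists W C (f : hom K W) (g : hom W C),
    [/\ ses f g, G C & has_resolution (fun=> X) n W].
Proof.
case: n => [|n].
  move=> /has_resolution_G0 => /(_ erefl) GK.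
  have [V [M' [f [g [XV GM' [fg _]]]]]] := Gorenstein_cosyzygy GK.
  exists V, M', f, g; split=> //; apply/has_resolution0.
  by exists V; split=> //; apply: isomorphic_refl.
move=> /has_resolutionS [L [C [l [d [ld GC rL]]]]].
have [V [C' [f [g [XV GC' [fg _]]]]]] := Gorenstein_cosyzygy GC.
have [W [q [i [p [lq ip]]]]] := ses_comp_mono ld fg.
exists W, C', i, p; split=> //; apply/has_resolutionS.
by exists L, V, (f \oc l), q.
Qed.

(** Push the sequence ending in [M] out along the hull [K -> W] of its first syzygy: the new middle
    term [Q] is an extension of an object of G by [V], and the new kernel is [W]. *)
Lemma resolution_end_start n M : has_resolution (fun k => if k == n then G else X) n M
  ->
  has_resolution (fun k => if k == 0%N then G else X) n M.
Proof.
elim: n M => [|n IHn] M //.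
move=> /has_resolutionS [K [V [k [e [ke XV /IHn /cosyzygy_resolution]]]]].
move=> [W [C [f [g [fg GC rW]]]]].
have [Q [a [b [e' [d' [be ad]]]]]] := ses_pushout2 ke fg.
apply/has_resolutionS; exists W, Q, b, e'; split=> //=.
by apply: (Gorenstein_extension Xadd Xorth) ad (XG XV) GC.
Qed.

Lemma resolution_start_any n t M : (t <= n)%N ->
  has_resolution (fun k => if k == 0%N then G else X) n M ->
  has_resolution (fun k => if k == t then G else X) n M.
Proof.
elim: t n M => [|t IHt] [|n] M //= tn.
move=> /resolution_step [//|C /XG //|K [V [k [e [ke XV rK]]]]].
by apply/has_resolutionS; exists K, V, k, e; split=> //; apply: IHt.
Qed.

Lemma resolution_Ext_vanish n M T i : X T -> has_resolution (fun=> G) n M -> Ext_vanish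
  (n + i).+1 M T.
Proof.
move=> XT; elim: n M => [|n IHn] M.
  by move=> /has_resolution_G0 => /(_ erefl) GM; apply: Gorenstein_Ext_vanish.
move=> /has_resolutionS [K [C [k [e [ke GC rK]]]]].
exact: Ext_vanish_cokernel ke (IHn _ rK) (Gorenstein_Ext_vanish GC XT).
Qed.

(** Each short exact sequence of coefficients trades one unit of X-dimension for one degree of Ext,
    so all degrees above n go through the induction together. *)
Lemma Ext_vanish_finite_dim n M l Y : (forall T i, X T -> Ext_vanish (n + i).+1 M T) ->
  has_resolution (fun=> X) l Y -> forall i, Ext_vanish (n + i).+1 M Y.
Proof.
have [Xiso _ _] := Xadd.
move=> evX; elim: l Y => [|l IHl] Y.
  by move=> /has_resolution0 [C [CY XC]] i; apply: evX; apply: Xiso XC.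
move=> /has_resolutionS [K [C [k [e [ke XC rK]]]]] i.
by apply: Ext_vanish_coeff ke (evX _ _ XC) _; rewrite -addnS; apply: IHl.
Qed.

(** [K'] inherits orthogonality to [X] and is in G by induction. Pushing out along its envelope
    [K' -> U] gives [Q] in G mapping onto [K] with kernel [U] in [X]; this splits since Ext^1(K, U)
    = 0, and [Gorenstein_summand] applies. *)
Lemma orthogonal_Gorenstein n K : has_resolution (fun=> G) n K ->
  (forall T i, X T -> Ext_vanish i.+1 K T) -> G K.
Proof.
elim: n K => [|n IHn] K rK evK;
  first exact: ((@has_resolution_G0 (fun=> G) K erefl).1 rK).
have [K' [V [k [e [ke XV rK']]]]] := G_resolution_step rK.
have GK' : G K'.
  apply: IHn rK' _ => T i XT.
  by apply: Ext_vanish_kernel ke (X_Ext_vanish XV XT) (evK _ _ XT).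
have [U [C [f [g [XU GC [fg _]]]]]] := Gorenstein_cosyzygy GK'.
have [Q [a [b [e' [d' [be ad]]]]]] := ses_pushout2 ke fg.
have GQ : G Q by apply: (Gorenstein_extension Xadd Xorth) ad (XG XV) GC.
have [s sE] := (Ext_vanish1P _ _).1 (evK _ 0%N XU) _ _ _ be.
exact: (Gorenstein_summand Xadd Xorth) be sE XU GQ.
Qed.

Lemma Ext_vanish_resolution n m M : has_resolution (fun=> G) m M ->
  (forall Y l, has_resolution (fun=> X) l Y -> Ext_vanish n.+1 M Y) ->
  has_resolution (fun=> G) n M.
Proof.
elim: n m M => [|n IHn] m M rM evM.
  apply/has_resolution_G0 => //; case: m rM => [|m] rM.
    exact: ((@has_resolution_G0 (fun=> G) M erefl).1 rM).
  have := resolution_end_start (resolution_end rM).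
  move=> /has_resolutionS [Y [C [k [e [ke GC rY]]]]].
  (* The kernel [Y] has finite X-dimension, so the hypothesis in degree 1 splits the approximation
     and [M] is a retract of [C]. *)
  have [s sE] := (Ext_vanish1P _ _).1 (evM _ _ rY) _ _ _ ke.
  apply: orthogonal_Gorenstein rM _ => T i XT.
  exact: Ext_vanish_retract sE (Gorenstein_Ext_vanish GC XT).
(* For m = 0 the resolution offers no syzygy to take; it is lengthened instead. *)
case: m rM => [|m] rM.
  have [Giso G0] : (forall B C, isomorphic B C -> G B -> G C) /\ (forall Z, zero_object
    Z -> G Z).
    split; first by move=> B C; apply: Gorenstein_iso.
    by have [_ X0 _] := Xadd => Z /X0 /XG.
  apply/(dim_leP _ _ G0 Giso); have /(dim_leP _ _ G0 Giso) := rM.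
  by rewrite /dim_le; case: dim => // k; rewrite leqn0 => /eqP ->.
have [K [V [k [e [ke XV rK]]]]] := G_resolution_step rM.
apply/has_resolutionS; exists K, V, k, e; split=> //; first exact: XG.
(* Degree n + 1 for the syzygy comes from degree n + 2 for [M], because Ext^(n+1)(V, Y) = 0 for [V]
   in [X]. *)
apply: IHn rK _ => Y l rY; apply: Ext_vanish_kernel ke _ (evM _ _ rY).
exact: (@Ext_vanish_finite_dim 0 V l Y (fun T i XT => X_Ext_vanish (n :=
  i) XV XT) rY n).
Qed.

End GorensteinDimension.

Theorem theorem5p8 (A : abelian_category) (X : A -> Prop) (M : A)
    (hadd : additive_subcategory X) (horth : self_orthogonal X)
    (hfin : dim_finite (Gorenstein X) M) (n : nat) :
  [<-> dim_le (Gorenstein X) M n;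
       has_resolution (fun k => if k == n then Gorenstein X else X) n M;
       has_resolution (fun k => if k == 0 then Gorenstein X else X) n M;
       forall t, t <= n ->
         has_resolution (fun k => if k == t then Gorenstein X else X) n M;
       forall T : A, X T -> forall i, 1 <= i -> Ext_eq0 (n + i) M T;
       forall Y : A, dim_finite X Y -> Ext_eq0 (n + 1) M Y;
       forall Y : A, dim_finite X Y -> forall i, 1 <= i -> Ext_eq0 (n + i) M Y].
Proof.
have G0 Z : zero_object Z -> Gorenstein X Z.
  by have [_ X0 _] := hadd => /X0 /(X_Gorenstein hadd).
have Giso B C : isomorphic B C -> Gorenstein X B -> Gorenstein X C by apply:
  Gorenstein_iso.
have [m rM] := (dim_finiteP _ _).1 hfin.
(* Finiteness of the G-dimension enters here, through [rM]. *)
have from6 : (forall Y : A, dim_finite X Y -> Ext_eq0 (n + 1) M Y) ->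
    has_resolution (fun=> Gorenstein X) n M.
  move=> ext; apply: (Ext_vanish_resolution hadd horth rM) => Y l rY.
  by apply/Ext_eq0P; rewrite -addn1; apply: ext; apply/dim_finiteP; exists l.
have to7 : (forall T : A, X T -> forall i, 1 <= i -> Ext_eq0 (n + i) M T) ->
    forall Y : A, dim_finite X Y -> forall i, 1 <= i -> Ext_eq0 (n + i) M Y.
  move=> ext Y /dim_finiteP [l rY] [|i] // _; rewrite addnS; apply/Ext_eq0P.
  apply: (Ext_vanish_finite_dim hadd _ rY) => T j XT.
  by apply/Ext_eq0P; rewrite -addnS; apply: ext.
have to5 : has_resolution (fun=> Gorenstein X) n M ->
    forall T : A, X T -> forall i, 1 <= i -> Ext_eq0 (n + i) M T.
  move=> rG T XT [|i] // _; rewrite addnS; apply/Ext_eq0P.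
  exact: (resolution_Ext_vanish horth XT rG).
tfae.
- by move=> /(dim_leP _ _ G0 Giso); apply: (resolution_end hadd horth).
- exact: (resolution_end_start hadd horth).
- by move=> r t tn; apply: (resolution_start_any hadd horth).
- move=> r; apply: to5; apply: has_resolution_mono (r 0 isT) => k C _.
  by case: eqP => // _; apply: (X_Gorenstein hadd).
- by move=> ext Y Yfin; apply: to7.
(* One degree does not yield the higher ones directly; the way leads through (1) and (5). *)
- by move=> /from6 /to5 /to7.
- by move=> ext; apply/(dim_leP _ _ G0 Giso); apply: from6 => Y Yfin; apply: ext.
Qed.
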